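(* Let $(\Sigma,\mathcal{T})$ be an ideally triangulated compact 3-dimensional manifold with boundary, with hyper-ideal vertex set $V=\{1,\dots,N\}$ and edge set $E$, and let $\Phi: E\to[0,\arccos\frac13]$ be a weight. If $\overline{r}$ is a non-degenerate generalized Thurston's sphere packing metric on $(\Sigma,\mathcal{T},\Phi)$ with $K_{ij}(\overline{r})\sin^2\Phi_{ij}\ge 0$ for every edge $\{ij\}\in E$, then there exists a neighborhood $U$ of $\overline{r}$ such that generalized Thurston's sphere packing metrics in $U$ are determined by their combinatorial scalar curvatures: if $r_1,r_2\in U$ are generalized Thurston's sphere packing metrics with $K_i(r_1)=K_i(r_2)$ for all $i\in V$, then $r_1=r_2$.
   Context: $\Sigma$ is obtained from a compact 3-manifold whose boundary has $N$ components by coning each boundary component to a point; an ideal triangulation $\mathcal{T}$ is a triangulation of $\Sigma$ whose vertices are exactly these cone points. Each tetrahedron is realized as a hyper-ideal tetrahedron: a compact convex polyhedron in $\mathbb{H}^3$ diffeomorphic to a truncated tetrahedron, with four right-angled hyperbolic hexagonal faces and four hyperbolic triangular ''vertex triangles'' $\triangle_i$ (one per vertex), each orthogonal to its three adjacent hexagons; the edge $\{ij\}$ (intersection of two hexagons) joins $\triangle_i$ to $\triangle_j$ and has length $l_{ij}$. A generalized Thurston's sphere packing metric is a map $r:V\to(0,\infty)$ such that, with $l_{ij}=\cosh^{-1}(\sinh r_i\sinh r_j+\cos\Phi_{ij}\cosh r_i\cosh r_j)$, for every tetrahedron $\{ijkh\}$ of $\mathcal T$ the six lengths $l_{ij},\dots,l_{kh}$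 are edge lengths of a non-degenerate hyper-ideal tetrahedron. The combinatorial Ricci curvature is $K_{ij}=2\pi-\sum_{\{ijkh\}\in T}\beta_{ij,kh}$, with $\beta_{ij,kh}$ the dihedral angle at $\{ij\}$ in tetrahedron $\{ijkh\}$, summed over tetrahedra containing $\{ij\}$. The combinatorial scalar curvature at $i\in V$ is $K_i=\sum_{j\sim i}K_{ij}\cosh\theta_{ij}$, where $\theta_{ij}$ is the length of the side opposite to the side of length $r_j$ in the hyperbolic (right-angled) pentagon with sides of lengths $r_i,r_j,l_{ij}$ determined by two spheres of radii $r_i,r_j$ meeting at angle $\Phi_{ij}$; equivalently $\cosh\theta_{ij}=\partial l_{ij}/\partial r_i=(\cosh r_i\sinh r_j+\cos\Phi_{ij}\sinh r_i\cosh r_j)/\sinh l_{ij}$. *)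

(* Defs.v *)
From HB Require Import structures.
From mathcomp Require Import all_boot all_order all_algebra.
From mathcomp Require Import all_classical all_reals all_analysis.
Set Implicit Arguments. Unset Strict Implicit. Unset Printing Implicit Defensive.
Import Order.TTheory GRing.Theory Num.Theory.
Local Open Scope ring_scope.

Section HyperIdeal.
Variable R : realType.

Definition sinh (x : R) : R := (expR x - expR (- x)) / 2.
Definition cosh (x : R) : R := (expR x + expR (- x)) / 2.
Definition acosh (x : R) : R := ln (x + Num.sqrt (x ^+ 2 - 1)).

Definition lorentzJ : 'M[R]_4 :=
  \matrix_(a < 4, b < 4) (if a == b then (if a == 0 :> 'I_4 then -1 else 1) else 0).

(* Gram matrix of the four (unit spacelike) vectors dual to the truncation
   planes of a hyper-ideal tetrahedron with edge lengths L a b (a <> b) *)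
Definition tet_gram (L : 'I_4 -> 'I_4 -> R) : 'M[R]_4 :=
  \matrix_(a < 4, b < 4) (if a == b then 1 else - cosh (L a b)).

(* L (a symmetric assignment of lengths to the six edges {ab}) is the edge
   length vector of a non-degenerate hyper-ideal tetrahedron:
   all lengths are positive and there are linearly independent vectors
   v_1..v_4 in R^{3,1} (rows of V) with <v_a,v_a> = 1 and
   <v_a,v_b> = - cosh L_ab, i.e. the truncation planes v_a^perp are
   pairwise ultraparallel at distance L_ab and each edge meets H^3. *)
Definition hyperideal_lengths (L : 'I_4 -> 'I_4 -> R) : Prop :=
  (forall a b, a != b -> 0 < L a b) /\
  exists V : 'M[R]_4, V \in unitmx /\ V *m lorentzJ *m V^T = tet_gram L.

Definition opp1 (a b : 'I_4) : 'I_4 :=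
  nth a [seq x <- enum 'I_4 | (x != a) && (x != b)] 0.
Definition opp2 (a b : 'I_4) : 'I_4 :=
  nth a [seq x <- enum 'I_4 | (x != a) && (x != b)] 1.

(* Dihedral angle at the edge {ab} of the hyper-ideal tetrahedron with edge
   lengths L: angle between the faces opposite to c and d ({c,d} the
   complementary edge), whose inward unit normals are the normalized dual
   vectors; their Gram matrix is the inverse Gram matrix. *)
Definition dihedral (L : 'I_4 -> 'I_4 -> R) (a b : 'I_4) : R :=
  let Gi := invmx (tet_gram L) in
  let c := opp1 a b in let d := opp2 a b in
  acos (- Gi c d / Num.sqrt (Gi c c * Gi d d)).

End HyperIdeal.

(* Vertices: 'I_N.  A tetrahedron {ijkh} is an injective map 'I_4 -> 'I_N;
   the triangulation is given by the (finite) list of its tetrahedra. *)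
Definition is_edge (N : nat) (T : seq {ffun 'I_4 -> 'I_N}) (i j : 'I_N) : bool :=
  (i != j) && has (fun t : {ffun 'I_4 -> 'I_N} => (i \in codom t) && (j \in codom t)) T.

Section Curvatures.
Variables (R : realType) (N : nat) (T : seq {ffun 'I_4 -> 'I_N})
          (Phi : 'I_N -> 'I_N -> R).

Definition cosh_len (r : 'I_N -> R) (i j : 'I_N) : R :=
  sinh (r i) * sinh (r j) + cos (Phi i j) * cosh (r i) * cosh (r j).

Definition len (r : 'I_N -> R) (i j : 'I_N) : R := acosh (cosh_len r i j).

Definition tet_len (r : 'I_N -> R) (t : {ffun 'I_4 -> 'I_N}) : 'I_4 -> 'I_4 -> R :=
  fun a b => len r (t a) (t b).

(* generalized Thurston's sphere packing metric (non-degenerate): r > 0,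
   the l_ij are well defined (cosh^{-1} of a number > 1), and in every
   tetrahedron the six lengths form a non-degenerate hyper-ideal tetrahedron *)
Definition sp_metric (r : 'I_N -> R) : Prop :=
  (forall i, 0 < r i) /\
  (forall i j, is_edge T i j -> 1 < cosh_len r i j) /\
  (forall t, t \in T -> hyperideal_lengths (tet_len r t)).

Definition Kedge (r : 'I_N -> R) (i j : 'I_N) : R :=
  2 * pi - \sum_(t <- T) \sum_(a : 'I_4) \sum_(b : 'I_4 | (t a == i) && (t b == j))
                dihedral (tet_len r t) a b.

(* cosh theta_ij = d l_ij / d r_i *)
Definition cosh_theta (r : 'I_N -> R) (i j : 'I_N) : R :=
  (cosh (r i) * sinh (r j) + cos (Phi i j) * sinh (r i) * cosh (r j))
    / sinh (len r i j).

Definition Kvert (r : 'I_N -> R) (i : 'I_N) : R :=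
  \sum_(j : 'I_N | is_edge T i j) Kedge r i j * cosh_theta r i j.

End Curvatures.

(* Main.v *)
Require Import Defs.
From HB Require Import structures.
From mathcomp Require Import all_boot all_order all_algebra.
From mathcomp Require Import all_classical all_reals all_analysis.
From mathcomp Require Import ring lra.
Import Order.TTheory GRing.Theory Num.Theory.
Import numFieldNormedType.Exports.
Set Implicit Arguments. Unset Strict Implicit. Unset Printing Implicit Defensive.
Local Open Scope classical_set_scope.
Local Open Scope ring_scope.

(* The curvature map is the gradient of a function of the radii whose Hessian at
   [rbar] is negative definite, hence it is locally injective (Rolle along
   segments). As [K_i = sum_j K_ij dl_ij/dr_i], the Hessian in direction [v] is
   the sum of [K_ij d^2 l_ij (v, v)] over the edges minus, over the tetrahedra,
   [sum dbeta_e dl_e]. The second derivative of [l_ij] is [- sin^2 Phi_ij] times a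
   positive definite form, so the sign condition on [K_ij sin^2 Phi_ij] disposes
   of the first sum.

   For a tetrahedron, [d beta / d l] is, up to scaling rows and columns by positive
   factors, a 6x6 symmetric matrix [M(k)] depending only on the cosines [k] of the
   dihedral angles. Its kernel is trivial because the angles determine the Gram
   matrix of the faces, hence the lengths. Increasing the cosines (decreasing the
   angles) preserves the hyper-ideal condition, so every [k] is joined to a regular
   tetrahedron with small angles, where [M] is diagonally dominant; by continuity
   [M(k)] is positive definite. Finally [dl = 0] on the edges of a triangle forces
   [v = 0] at its vertices. *)

(** * Symmetric 4x4 matrices with unit diagonal *)

(** The sign condition is given at [rbar] alone, so negativity at nearby radii has to come from
    openness: it is uniform in the direction because a quadratic form need only be tested on the
    compact unit sphere. Rolle's theorem is applied to the pairing of the curvature with the fixed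
    direction [r1 - r2]; its values at the two ends of the segment agree, and its derivative is the
    quadratic form itself. The intermediate radii only need to satisfy strict inequalities on
    [cosh l] and on Gram determinants. The link between lengths and angles is Jacobi's identity for
    complementary minors. Inverting the Gram matrix of the truncation planes and normalising its
    diagonal gives the Gram matrix of the faces, whose entries are the cosines; every sign condition
    on one side is then read off from the other. The same identity expresses [sinh l] through the
    2x2 minor that occurs in the derivative of the angle, which makes the Jacobian symmetric. The
    deformation is carried out in the cosines, where a single entry can be raised while all these
    signs persist. *)

Definition o0 : 'I_4 := @Ordinal 4 0 isT.
Definition o1 : 'I_4 := @Ordinal 4 1 isT.
Definition o2 : 'I_4 := @Ordinal 4 2 isT.
Definition o3 : 'I_4 := @Ordinal 4 3 isT.

Lemma ord4P (P : 'I_4 -> Prop) : P o0 -> P o1 -> P o2 -> P o3 -> forall i, P i.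
Proof.
move=> h0 h1 h2 h3 [[|[|[|[|//]]]] lt_i].
- by rewrite (_ : Ordinal _ = o0) //; apply: val_inj.
- by rewrite (_ : Ordinal _ = o1) //; apply: val_inj.
- by rewrite (_ : Ordinal _ = o2) //; apply: val_inj.
- by rewrite (_ : Ordinal _ = o3) //; apply: val_inj.
Qed.

Lemma sum4E (V : nmodType) (F : 'I_4 -> V) :
  \sum_i F i = F o0 + F o1 + F o2 + F o3.
Proof.
rewrite !big_ord_recl big_ord0 addr0 !addrA.
by congr (F _ + F _ + F _ + F _); apply: val_inj.
Qed.

Section Minors.
Variable R : comNzRingType.
Implicit Types x y z : R.

(* In [minor3], [cof_off] and [ndet4] the arguments are the entries of a symmetric
   matrix with unit diagonal, with the opposite sign off the diagonal: [minor3] is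
   minus its 3x3 principal minor, [ndet4] minus its determinant, and
   [cof_off x_ab x_cd x_ac x_bc x_ad x_bd] its cofactor at (a, b). *)
Definition minor3 x y z : R := x ^+ 2 + y ^+ 2 + z ^+ 2 + 2 * x * y * z - 1.

Definition cof_off e o p q p' q' : R :=
  e * (1 - o ^+ 2) + p * q + p' * q' + o * (p * q' + p' * q).

Definition ndet4 (a b c d e f : R) : R :=
  a ^+ 2 + b ^+ 2 + c ^+ 2 + d ^+ 2 + e ^+ 2 + f ^+ 2 - 1
  + 2 * (a * b * d + a * c * e + b * c * f + d * e * f)
  - (a * f) ^+ 2 - (b * e) ^+ 2 - (c * d) ^+ 2
  + 2 * (a * f * (b * e) + a * f * (c * d) + b * e * (c * d)).

(** This matrix plays two roles: with the hyperbolic cosines of the lengths it is the Gram matrix of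
    the truncation planes, with the cosines of the dihedral angles that of the faces. *)
Definition G4 (x01 x02 x03 x12 x13 x23 : R) : 'M[R]_4 :=
  \matrix_(i, j) match nat_of_ord i, nat_of_ord j with
  | 0, 1 | 1, 0 => - x01 | 0, 2 | 2, 0 => - x02 | 0, 3 | 3, 0 => - x03
  | 1, 2 | 2, 1 => - x12 | 1, 3 | 3, 1 => - x13 | 2, 3 | 3, 2 => - x23
  | _, _ => 1 end.

Definition adj4 (x01 x02 x03 x12 x13 x23 : R) : 'M[R]_4 :=
  \matrix_(i, j) match nat_of_ord i, nat_of_ord j with
  | 0, 0 => - minor3 x12 x13 x23 | 1, 1 => - minor3 x02 x03 x23
  | 2, 2 => - minor3 x01 x03 x13 | 3, 3 => - minor3 x01 x02 x12
  | 0, 1 | 1, 0 => cof_off x01 x23 x02 x12 x03 x13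
  | 0, 2 | 2, 0 => cof_off x02 x13 x01 x12 x03 x23
  | 0, 3 | 3, 0 => cof_off x03 x12 x01 x13 x02 x23
  | 1, 2 | 2, 1 => cof_off x12 x03 x01 x02 x13 x23
  | 1, 3 | 3, 1 => cof_off x13 x02 x01 x03 x12 x23
  | 2, 3 | 3, 2 => cof_off x23 x01 x02 x03 x12 x13
  | _, _ => 0 end.

Lemma mul_G4_adj4 a b c d e f :
  G4 a b c d e f *m adj4 a b c d e f = (- ndet4 a b c d e f)%:M.
Proof.
apply/matrixP => i j; rewrite mxE sum4E !mxE.
move: i j; apply: ord4P; apply: ord4P => /=;
  rewrite ?mulr1n ?mulr0n /ndet4 /minor3 /cof_off; ring.
Qed.

(** Entries are indexed by [nat] so that the shifts [bump] produced by cofactor expansion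
    compute. *)
Lemma det_matrix3 (a : nat -> nat -> R) :
  \det (\matrix_(i < 3, j < 3) a i j) =
  a 0%N 0%N * (a 1%N 1%N * a 2%N 2%N - a 1%N 2%N * a 2%N 1%N)
  - a 0%N 1%N * (a 1%N 0%N * a 2%N 2%N - a 1%N 2%N * a 2%N 0%N)
  + a 0%N 2%N * (a 1%N 0%N * a 2%N 1%N - a 1%N 1%N * a 2%N 0%N).
Proof.
rewrite (expand_det_row _ (ord0 : 'I_3)) !big_ord_recl big_ord0 /cofactor.
rewrite !(expand_det_row _ (ord0 : 'I_2)) !big_ord_recl !big_ord0 /cofactor.
by rewrite !det_mx11 !mxE /= /bump /=; ring.
Qed.

Lemma det_matrix4 (a : nat -> nat -> R) : \det (\matrix_(i < 4, j < 4) a i j) =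
  \sum_(j < 4) a 0%N j * ((-1) ^+ j *
    \det (\matrix_(i < 3, k < 3) a i.+1 (bump j k))).
Proof.
rewrite (expand_det_row _ (ord0 : 'I_4)); apply: eq_bigr => j _.
rewrite /cofactor mxE add0n; congr (_ * (_ * \det _)).
by apply/matrixP => i k; rewrite !mxE.
Qed.

Lemma det_G4 a b c d e f : \det (G4 a b c d e f) = - ndet4 a b c d e f.
Proof.
pose g (i j : nat) : R := match i, j with
  | 0, 1 | 1, 0 => - a | 0, 2 | 2, 0 => - b | 0, 3 | 3, 0 => - c
  | 1, 2 | 2, 1 => - d | 1, 3 | 3, 1 => - e | 2, 3 | 3, 2 => - f
  | _, _ => 1 end.
have -> : G4 a b c d e f = \matrix_(i < 4, j < 4) g i j by apply/matrixP => i j; rewrite !mxE.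
rewrite det_matrix4 sum4E; have M j := det_matrix3 (fun i k => g i.+1 (bump j k)).
by rewrite !M /bump /= /ndet4; ring.
Qed.

End Minors.

Section Kernel.
Variables (F : fieldType) (n : nat).

(* Writing H U H = L H + H L and conjugating by H^-1 turns the zero diagonal of
   U into L = 0. *)
Lemma infinitesimal_rigidity (H U : 'M[F]_n) :
  H \in unitmx -> (forall i, H i i = 1) -> (forall i, invmx H i i != 0) ->
  2 != 0 :> F ->
  (forall i, U i i = 0) ->
  (forall i j, (H *m U *m H) i j =
     H i j * ((H *m U *m H) i i + (H *m U *m H) j j) / 2) ->
  U = 0.
Proof.
move=> uH H1 G0 two0 U0; have [W W0] : exists W, W = H *m U *m H by eexists.
rewrite -W0 => E.
pose L : 'M[F]_n := diag_mx (\row_i (W i i / 2)).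
have WE : W = L *m H + H *m L.
  apply/matrixP => i j; rewrite E mxE mul_diag_mx mul_mx_diag !mxE; field.
  exact: two0.
have UE : U = invmx H *m L + L *m invmx H.
  have : invmx H *m W *m invmx H = U.
    by rewrite W0 !mulmxA mulVmx // mul1mx -mulmxA mulmxV // mulmx1.
  move=> <-; rewrite WE mulmxDr mulmxDl addrC !mulmxA mulVmx // mul1mx.
  by rewrite -[_ *m H *m invmx H]mulmxA mulmxV // mulmx1 addrC.
have L0 : L = 0.
  apply/matrixP => i j; rewrite !mxE; case: eqVneq => [_|_]; rewrite ?mulr0n ?mulr1n //.
  have := congr1 (fun M : 'M[F]_n => M i i) UE.
  rewrite U0 mxE mul_diag_mx mul_mx_diag !mxE => /esym.
  rewrite [_ * invmx H i i]mulrC -mulr2n -[_ *+ 2]mulr_natl => /eqP.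
  by rewrite mulf_eq0 (negbTE two0) /= mulf_eq0 (negbTE (G0 _)) /= => /eqP.
by rewrite UE L0 mulmx0 mul0mx addr0.
Qed.
End Kernel.

(** * Cosines of the dihedral angles of a hyper-ideal tetrahedron *)

Section Cosines.
Variable R : rcfType.

(** Intermediate value theorem in the degree needed below: a cofactor is at most quadratic in each
    single cosine. *)
Lemma quad_pos (a b c d : R) : 0 <= d -> 0 < a ->
  (forall s, 0 <= s <= d -> a + b * s + c * s ^+ 2 != 0) ->
  0 < a + b * d + c * d ^+ 2.
Proof.
move=> d0 a0 nz; rewrite ltNge; apply/negP => le0.
pose p : {poly R} := a%:P + b *: 'X + c *: 'X^2.
have pE s : p.[s] = a + b * s + c * s ^+ 2 by rewrite /p !hornerE.
(* [poly_ivt] expects a nonpositive value at the left end, hence the opposite of [p]. *)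
have [|s /andP[s0 sd] /rootP ps] := @poly_ivt R (- p) 0 d d0.
  rewrite !hornerN !pE; apply/andP; split; lra.
have := nz s; rewrite s0 sd => /(_ isT)/eqP; apply.
by move: ps; rewrite hornerN pE => /eqP; rewrite oppr_eq0 => /eqP.
Qed.

(** The conditions for [x], [y], [z] to be the cosines of the angles of a hyperbolic triangle, here
    a vertex triangle: by the law of cosines a side has hyperbolic cosine [(x + y * z) / sqrt ((1 -
    y ^+ 2) * (1 - z ^+ 2))], and [0 < minor3 x y z] says that its square exceeds 1. *)
Definition triple_adm (x y z : R) : Prop :=
  [/\ 0 < minor3 x y z,
      [/\ x ^+ 2 < 1, y ^+ 2 < 1 & z ^+ 2 < 1] &
      [/\ 0 < x + y * z, 0 < y + x * z & 0 < z + x * y]].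

Lemma triple_adm12 x y z : triple_adm x y z -> triple_adm y x z.
Proof.
case=> m [hx hy hz] [h1 h2 h3]; split; first by move: m; rewrite /minor3; lra.
  by split.
by split => //; move: h3; rewrite mulrC.
Qed.

Lemma triple_adm23 x y z : triple_adm x y z -> triple_adm x z y.
Proof.
case=> m [hx hy hz] [h1 h2 h3]; split; first by move: m; rewrite /minor3; lra.
  by split.
by split => //; move: h1; rewrite mulrC.
Qed.

(** The derivative of [minor3] in [x] is [2 * (x + y * z)], which is positive and stays so. The
    other two numerators cannot vanish on the way, since the square of each is [minor3] plus a
    product of two positive factors; so they keep their sign. *)
Lemma triple_adm_raise d x y z : 0 <= d -> x + d < 1 ->
  triple_adm x y z -> triple_adm (x + d) y z.
Proof.
move=> d0 xd [m [hx hy hz] [h1 h2 h3]].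
have msE s : minor3 (x + s) y z = minor3 x y z + 2 * s * (x + y * z) + s ^+ 2.
  by rewrite /minor3; ring.
have ms s : 0 <= s -> 0 < minor3 (x + s) y z.
  by move=> s0; rewrite msE; have := mulr_ge0 s0 (ltW h1); have := sqr_ge0 s; lra.
have sq s : 0 <= s <= d -> (x + s) ^+ 2 < 1.
  move=> /andP[s0 sd]; have [? ?] : -1 < x /\ x < 1.
    by split; rewrite ltNge; apply/negP => h; nra.
  nra.
have key u v s : u ^+ 2 < 1 -> v ^+ 2 < 1 -> minor3 u v (x + s) > 0 ->
    0 <= s <= d -> (u + v * x + v * s) ^+ 2 != 0.
  move=> hu hv mm /sq hs; rewrite gt_eqF //.
  have -> : (u + v * x + v * s) ^+ 2
      = minor3 u v (x + s) + (1 - v ^+ 2) * (1 - (x + s) ^+ 2).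
    by rewrite /minor3; ring.
  by rewrite addr_gt0 // mulr_gt0 // subr_gt0.
split; first exact: ms.
  by split => //; apply: sq; rewrite d0 lexx.
split; first lra.
- have -> : y + (x + d) * z = (y + x * z) + z * d + 0 * d ^+ 2 by ring.
  apply: quad_pos => // s hs; rewrite mul0r addr0.
  have := key y z s hy hz; rewrite [z * x]mulrC => H.
  rewrite -sqrf_eq0; apply: H => //.
  by have := ms s; case/andP: hs => s0 _ /(_ s0); rewrite /minor3; lra.
- have -> : z + (x + d) * y = (z + x * y) + y * d + 0 * d ^+ 2 by ring.
  apply: quad_pos => // s hs; rewrite mul0r addr0.
  have := key z y s hz hy; rewrite [y * x]mulrC => H.
  rewrite -sqrf_eq0; apply: H => //.
  by have := ms s; case/andP: hs => s0 _ /(_ s0); rewrite /minor3; lra.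
Qed.

(* [k_ij] is minus the inner product of the unit normals of the faces i and j, the
   cosine of the dihedral angle between them. The conditions say that the inverse
   of the Gram matrix of the faces has positive diagonal and negative off-diagonal
   entries. *)
Definition cosines_adm (k01 k02 k03 k12 k13 k23 : R) : Prop :=
  [/\ 0 < ndet4 k01 k02 k03 k12 k13 k23,
      [/\ triple_adm k12 k13 k23, triple_adm k02 k03 k23,
          triple_adm k01 k03 k13 & triple_adm k01 k02 k12],
      [/\ 0 < cof_off k01 k23 k02 k12 k03 k13, 0 < cof_off k02 k13 k01 k12 k03 k23
        & 0 < cof_off k03 k12 k01 k13 k02 k23] &
      [/\ 0 < cof_off k12 k03 k01 k02 k13 k23, 0 < cof_off k13 k02 k01 k03 k12 k23
        & 0 < cof_off k23 k01 k02 k03 k12 k13]].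

(** Transpositions of adjacent indices generate all relabellings of the faces, so that it is enough
    to study the raising of [k01]. *)
Lemma cosines_adm01 a b c d e f :
  cosines_adm a b c d e f -> cosines_adm a d e b c f.
Proof.
case=> h [t0 t1 t2 t3] [w01 w02 w03] [w12 w13 w23]; split.
- by move: h; rewrite /ndet4; lra.
- split=> //; [exact: triple_adm23|exact: triple_adm23].
- split; [move: w01|move: w12|move: w13]; rewrite /cof_off; lra.
- split; [move: w02|move: w03|move: w23]; rewrite /cof_off; lra.
Qed.

Lemma cosines_adm12 a b c d e f :
  cosines_adm a b c d e f -> cosines_adm b a c d f e.
Proof.
case=> h [t0 t1 t2 t3] [w01 w02 w03] [w12 w13 w23]; split.
- by move: h; rewrite /ndet4; lra.
- split=> //; [exact: triple_adm23|exact: triple_adm12].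
- split; [move: w02|move: w01|move: w03]; rewrite /cof_off; lra.
- split; [move: w12|move: w23|move: w13]; rewrite /cof_off; lra.
Qed.

Lemma cosines_adm23 a b c d e f :
  cosines_adm a b c d e f -> cosines_adm a c b e d f.
Proof.
case=> h [t0 t1 t2 t3] [w01 w02 w03] [w12 w13 w23]; split.
- by move: h; rewrite /ndet4; lra.
- split=> //; [exact: triple_adm12|exact: triple_adm12].
- split; [move: w01|move: w03|move: w02]; rewrite /cof_off; lra.
- split; [move: w13|move: w12|move: w23]; rewrite /cof_off; lra.
Qed.

(** Jacobi's identity for a principal 2x2 minor of the adjugate, with complementary minor
    [1 - k23 ^+ 2]. Its right-hand side is positive under [cosines_adm]. *)
Lemma jacobi_off k01 k02 k03 k12 k13 k23 :
  (cof_off k01 k23 k02 k12 k03 k13 : R) ^+ 2 =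
  minor3 k12 k13 k23 * minor3 k02 k03 k23
  + (1 - k23 ^+ 2) * ndet4 k01 k02 k03 k12 k13 k23.
Proof. rewrite /cof_off /minor3 /ndet4; ring. Qed.

(* The determinant and the principal minors are monotone as long as the cofactors
   are positive, and the Jacobi identity keeps the cofactors away from 0. *)
Lemma cosines_adm_raise01 s a b c d e f : 0 <= s -> a + s < 1 ->
  cosines_adm a b c d e f -> cosines_adm (a + s) b c d e f.
Proof.
move=> s0 sa [h [t0 t1 t2 t3] [w01 w02 w03] [w12 w13 w23]].
have [p0 [d1 e1 f1] _] := t0; have [p1 [b1 c1 _] _] := t1.
have f2 : 0 < 1 - f ^+ 2 by lra.
have detE r : ndet4 (a + r) b c d e f = ndet4 a b c d e f +
    2 * r * cof_off a f b d c e + r ^+ 2 * (1 - f ^+ 2).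
  by rewrite /ndet4 /cof_off; ring.
have det r : 0 <= r -> 0 < ndet4 (a + r) b c d e f.
  move=> r0; rewrite detE; have := mulr_ge0 r0 (ltW w01).
  have := mulr_ge0 (sqr_ge0 r) (ltW f2); lra.
have T2 r : 0 <= r <= s -> triple_adm (a + r) c e.
  by move=> /andP[r0 rs]; apply: triple_adm_raise => //; lra.
have T3 r : 0 <= r <= s -> triple_adm (a + r) b d.
  by move=> /andP[r0 rs]; apply: triple_adm_raise => //; lra.
have nz (W p q x n : R) : W ^+ 2 = p * q + x * n -> 0 < p -> 0 < q -> 0 < x -> 0 < n ->
    W != 0.
  move=> E hp hq hx hn; rewrite -sqrf_eq0 E gt_eqF //.
  by rewrite addr_gt0 // mulr_gt0.
have s1 : 0 <= s <= s by rewrite s0 lexx.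
split; [exact: det|split => //; [exact: T2|exact: T3]| |].
- split.
  + have -> : cof_off (a + s) f b d c e = cof_off a f b d c e + s * (1 - f ^+ 2).
      by rewrite /cof_off; ring.
    by have := mulr_ge0 s0 (ltW f2); lra.
  + have Wr r : cof_off b e (a + r) d c f = cof_off b e a d c f + (d + e * f) * r + 0 * r ^+ 2.
      by rewrite /cof_off; ring.
    rewrite Wr; apply: quad_pos => // r hr; rewrite -Wr.
    have [r0 _] := andP hr; have [p2 [_ c2 e2] _] := T2 _ hr.
    apply: (nz _ (minor3 d e f) (minor3 (a + r) c e) (1 - e ^+ 2) (ndet4 (a + r) b c d e f)) => //.
    * by rewrite /cof_off /minor3 /ndet4; ring.
    * by lra.
    * exact: det.
  + have Wr r : cof_off c d (a + r) e b f = cof_off c d a e b f + (e + d * f) * r + 0 * r ^+ 2.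
      by rewrite /cof_off; ring.
    rewrite Wr; apply: quad_pos => // r hr; rewrite -Wr.
    have [r0 _] := andP hr; have [p2 _ _] := T3 _ hr.
    apply: (nz _ (minor3 d e f) (minor3 (a + r) b d) (1 - d ^+ 2) (ndet4 (a + r) b c d e f)) => //.
    * by rewrite /cof_off /minor3 /ndet4; ring.
    * by lra.
    * exact: det.
- split.
  + have Wr r : cof_off d c (a + r) b e f = cof_off d c a b e f + (b + c * f) * r + 0 * r ^+ 2.
      by rewrite /cof_off; ring.
    rewrite Wr; apply: quad_pos => // r hr; rewrite -Wr.
    have [r0 _] := andP hr; have [p2 _ _] := T2 _ hr.
    apply: (nz _ (minor3 b c f) (minor3 (a + r) c e) (1 - c ^+ 2) (ndet4 (a + r) b c d e f)) => //.
    * by rewrite /cof_off /minor3 /ndet4; ring.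
    * by lra.
    * exact: det.
  + have Wr r : cof_off e b (a + r) c d f = cof_off e b a c d f + (c + b * f) * r + 0 * r ^+ 2.
      by rewrite /cof_off; ring.
    rewrite Wr; apply: quad_pos => // r hr; rewrite -Wr.
    have [r0 _] := andP hr; have [p2 _ _] := T3 _ hr.
    apply: (nz _ (minor3 b c f) (minor3 (a + r) b d) (1 - b ^+ 2) (ndet4 (a + r) b c d e f)) => //.
    * by rewrite /cof_off /minor3 /ndet4; ring.
    * by lra.
    * exact: det.
  (* The cofactor at the opposite pair of faces is the only one of degree two in the raised
     cosine. *)
  + have Wr r : cof_off f (a + r) b c d e = cof_off f a b c d e
        + (b * e + c * d - 2 * a * f) * r + (- f) * r ^+ 2.
      by rewrite /cof_off; ring.
    rewrite Wr; apply: quad_pos => // r hr; rewrite -Wr.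
    have [r0 _] := andP hr; have [p2 [a2 _ _] _] := T2 _ hr; have [p3 _ _] := T3 _ hr.
    apply: (nz _ (minor3 (a + r) c e) (minor3 (a + r) b d) (1 - (a + r) ^+ 2) (ndet4 (a + r) b c d e f)) => //.
    * by rewrite /cof_off /minor3 /ndet4; ring.
    * by lra.
    * exact: det.
Qed.

Lemma cosines_adm_le a b c d e f a' b' c' d' e' f' :
  a <= a' < 1 -> b <= b' < 1 -> c <= c' < 1 -> d <= d' < 1 -> e <= e' < 1 -> f <= f' < 1 ->
  cosines_adm a b c d e f -> cosines_adm a' b' c' d' e' f'.
Proof.
have raise a1 a2 b1 c1 d1 e1 f1 : a1 <= a2 < 1 ->
    cosines_adm a1 b1 c1 d1 e1 f1 -> cosines_adm a2 b1 c1 d1 e1 f1.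
  move=> /andP[? ?] h; rewrite (_ : a2 = a1 + (a2 - a1)); last by ring.
  by apply: cosines_adm_raise01 => //; lra.
move=> ha hb hc hd he hf H.
have {}H := raise _ _ _ _ _ _ _ ha H.
have {}H := cosines_adm12 (raise _ _ _ _ _ _ _ hb (cosines_adm12 H)).
have {}H := cosines_adm23 (cosines_adm12 (raise _ _ _ _ _ _ _ hc
  (cosines_adm12 (cosines_adm23 H)))).
have {}H := cosines_adm01 (cosines_adm12 (raise _ _ _ _ _ _ _ hd
  (cosines_adm12 (cosines_adm01 H)))).
have {}H := cosines_adm01 (cosines_adm23 (cosines_adm12
  (raise _ _ _ _ _ _ _ he
  (cosines_adm12 (cosines_adm23 (cosines_adm01 H)))))).
have {}H := cosines_adm12 (cosines_adm01 (cosines_adm23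
  (cosines_adm12 (raise _ _ _ _ _ _ _ hf
  (cosines_adm12 (cosines_adm23 (cosines_adm01
     (cosines_adm12 H)))))))).
exact: H.
Qed.

End Cosines.

(** * Families of positive definite forms *)

Section Forms.
Variable R : realType.

(** By homogeneity only the unit sphere matters, and joint convergence there is uniform by
    compactness. The forms are arbitrary functions, not matrices, so that the lemma applies both to
    [qform] and to [hess_form]. *)
Lemma near_pos_form (I : Type) (F : set_system I) {FF : Filter F} n
    (q : I -> 'rV[R]_n -> R) (q0 : 'rV[R]_n -> R) :
  (forall i k v, q i (k *: v) = k ^+ 2 * q i v) ->
  (forall v, v != 0 -> 0 < q0 v) ->
  (forall v, q z.2 z.1 @[z --> (nbhs v, F)] --> q0 v) ->
  \forall i \near F, forall v, v != 0 -> 0 < q i v.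
Proof.
move=> qZ q0_gt0 qcvg; pose S : set 'rV[R]_n := [set v | `|v| = 1].
have cS : compact S.
  apply: bounded_closed_compact.
    exists 1; split; first exact: num_real.
    by move=> x x1 v /= ->; apply: ltW.
  apply: (@closed_comp _ _ _ [set x : R | x = 1]).
    by move=> v _; exact: norm_continuous.
  exact: closed_eq.
have /(_ I F (fun i v => 0 < q i v) FF) := (compact_near_coveringP S).1 cS.
have : forall v, S v -> \near v & F, 0 < q F v.
  move=> v Sv; have v0 : v != 0.
    by apply/eqP => v0; move: Sv; rewrite /S /= v0 normr0 => /esym/eqP; rewrite oner_eq0.
  have := cvgr_gt _ (qcvg v) _ (q0_gt0 _ v0).
  exact.
move=> h /(_ h) near_q; near=> i => v v0.
have qS : forall w, S w -> 0 < q i w by near: i.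
have nv : 0 < `|v| by rewrite normr_gt0.
have -> : v = `|v| *: (`|v|^-1 *: v) by rewrite scalerA divff ?scale1r ?gt_eqF.
rewrite qZ mulr_gt0 ?exprn_gt0 // qS // /S /= normrZ ger0_norm ?invr_ge0 ?ltW //.
by rewrite mulVf ?gt_eqF.
Unshelve. all: by end_near. Qed.

Lemma cvg_sum (T : Type) (F : set_system T) {FF : Filter F} (I : Type) (r : seq I)
    (P : pred I) (f : I -> T -> R) (a : I -> R) :
  (forall i, P i -> f i x @[x --> F] --> a i) ->
  \sum_(i <- r | P i) f i x @[x --> F] --> \sum_(i <- r | P i) a i.
Proof. by apply: cvg_big; exact: add_continuous. Qed.

Lemma cvg_prod (T : Type) (F : set_system T) {FF : Filter F} (I : Type) (r : seq I)
    (P : pred I) (f : I -> T -> R) (a : I -> R) :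
  (forall i, P i -> f i x @[x --> F] --> a i) ->
  \prod_(i <- r | P i) f i x @[x --> F] --> \prod_(i <- r | P i) a i.
Proof. by apply: cvg_big; exact: mul_continuous. Qed.

Lemma cvg_exprn (T : Type) (F : set_system T) {FF : Filter F} (n : nat)
    (f : T -> R) (a : R) :
  f x @[x --> F] --> a -> f x ^+ n @[x --> F] --> a ^+ n.
Proof.
move=> fa; apply: (@cvg_comp _ _ _ f (fun y => y ^+ n) F _ _ fa).
exact: exprn_continuous.
Qed.

Definition qform n (M : 'M[R]_n) (v : 'rV[R]_n) : R := (v *m M *m v^T) 0 0.

Definition pos_def n (M : 'M[R]_n) := forall v : 'rV[R]_n, v != 0 -> 0 < qform M v.

Lemma qformE n (M : 'M[R]_n) v :
  qform M v = \sum_j (\sum_i v 0 i * M i j) * v 0 j.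
Proof. by rewrite /qform mxE; apply: eq_bigr => j _; rewrite !mxE. Qed.

Lemma qformZ n (M : 'M[R]_n) k v : qform M (k *: v) = k ^+ 2 * qform M v.
Proof.
by rewrite /qform linearZ /= -!scalemxAl -scalemxAr scalerA [LHS]mxE.
Qed.

Lemma qform_cvg n (T : Type) (F : set_system T) {FF : Filter F}
    (M : T -> 'M[R]_n) (M0 : 'M[R]_n) (w : T -> 'rV[R]_n) (v : 'rV[R]_n) :
  (forall i j, M x i j @[x --> F] --> M0 i j) ->
  (forall i, w x 0 i @[x --> F] --> v 0 i) ->
  qform (M x) (w x) @[x --> F] --> qform M0 v.
Proof.
move=> cM cw; under eq_cvg do rewrite qformE.
rewrite qformE; apply: cvg_sum => j _; apply: cvgM => //.
by apply: cvg_sum => i _; apply: cvgM.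
Qed.

(** A null vector minimises a semidefinite form, so the first variation in the direction [v *m M],
    which is twice the squared norm [N] of that vector, must vanish. *)
Lemma semidef_kernel n (M : 'M[R]_n) (v : 'rV[R]_n) : M^T = M ->
  (forall w, 0 <= qform M w) -> qform M v <= 0 -> v *m M = 0.
Proof.
move=> MT M0 v0; have [w wE] : exists w, w = v *m M by eexists.
pose N := (w *m w^T) 0 0.
have NE : N = \sum_i w 0 i ^+ 2.
  by rewrite /N mxE; apply: eq_bigr => i _; rewrite mxE -expr2.
have N_ge0 : 0 <= N by rewrite NE; apply: sumr_ge0 => i _; apply: sqr_ge0.
have qE t : qform M (v + t *: w) = qform M v + 2 * t * N + t ^+ 2 * qform M w.
  rewrite /qform linearD linearZ /= !mulmxDl !mulmxDr -!scalemxAl -!scalemxAr.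
  have -> : w *m M *m v^T = w *m w^T by rewrite {3}wE trmx_mul MT !mulmxA.
  have D (A B : 'M[R]_1) : (A + B) 0 0 = A 0 0 + B 0 0 by rewrite mxE.
  have Z k (A : 'M[R]_1) : (k *: A) 0 0 = k * A 0 0 by rewrite mxE.
  by rewrite -wE !(D, Z) -/N; ring.
have N0 : N = 0.
  have c0 := M0 w; set c := qform M w in c0 qE.
  have c1 : 0 < c + 1 by lra.
  (* The minimiser of [2 * t * N + t ^+ 2 * c] would be [- N / c]; since [c] may be 0, the
     denominator is [c + 1], which still gives a negative value when [N] is not 0. *)
  have := M0 (v + (- N / (c + 1)) *: w); rewrite qE => h.
  have E : (c + 1) ^+ 2 * (2 * (- N / (c + 1)) * N + (- N / (c + 1)) ^+ 2 * c) = - N ^+ 2 * (c + 2).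
    by field; rewrite gt_eqF.
  have : 0 <= - N ^+ 2 * (c + 2).
    by rewrite -E mulr_ge0 ?sqr_ge0 //; lra.
  have : 0 <= N ^+ 2 * c by rewrite mulr_ge0 ?sqr_ge0.
  move=> h1 h2; apply/eqP; rewrite -sqrf_eq0 eq_le sqr_ge0 andbT; lra.
apply/rowP => i; rewrite -wE [RHS]mxE; apply/eqP; rewrite -sqrf_eq0.
have /psumr_eq0P : \sum_i w 0 i ^+ 2 = 0 by rewrite -NE.
by move=> -> // *; apply: sqr_ge0.
Qed.

(** Let [s0] be the supremum of the parameters where definiteness fails. If [M s0] were definite, so
    would be its neighbours, contradicting the choice of [s0]. Otherwise [s0 < 1], [M s0] is a limit
    of definite matrices from the right, hence semidefinite, and a null vector lies in its
    kernel. *)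
Lemma pos_def_path n (M : R -> 'M[R]_n) :
  (forall s : R, 0 <= s <= 1 -> forall i j, M x i j @[x --> s] --> M s i j) ->
  (forall s, (M s)^T = M s) ->
  (forall s : R, 0 <= s <= 1 -> forall v : 'rV_n, v *m M s = 0 -> v = 0) ->
  pos_def (M 1) -> pos_def (M 0).
Proof.
move=> Mc MT Mker M1; apply: contrapT => M0.
have near_pd s : 0 <= s <= 1 -> pos_def (M s) -> \forall x \near s, pos_def (M x).
  move=> s01 Ms.
  apply: (@near_pos_form _ (nbhs s) _ n (fun x => qform (M x)) _ (fun x => qformZ (M x)) Ms) => v.
  apply: qform_cvg => [i j|i].
    by apply: (@cvg_comp _ _ _ snd (fun x => M x i j) _ _ _ cvg_snd); exact: Mc.
  apply: (@cvg_comp _ _ _ fst (fun w : 'rV[R]_n => w 0 i) _ _ _ cvg_fst).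
  exact: coord_continuous.
pose B : set R := [set s | 0 <= s <= 1 /\ ~ pos_def (M s)].
have B0 : B 0 by split => //; rewrite lexx ler01.
have supB : has_sup B.
  by split; [exists 0|exists 1 => s [/andP[]]].
set s0 := sup B.
have s0_ge0 : 0 <= s0 by apply: sup_upper_bound.
have s0_le1 : s0 <= 1 by apply: ge_sup => [|s [/andP[]]]; first by exists 0.
have s01 : 0 <= s0 <= 1 by rewrite s0_ge0.
have [Ms0|nMs0] := pselect (pos_def (M s0)).
  have /nbhs_ballP[e /= e0 he] := near_pd _ s01 Ms0.
  have [b Bb bs] := sup_adherent e0 supB.
  have [_] := Bb; apply; apply: he; rewrite /ball /= ger0_norm ?subr_ge0 ?(sup_upper_bound supB) //.
  by rewrite ltrBlDr -ltrBlDl.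
have s0_lt1 : s0 < 1.
  by rewrite lt_neqAle s0_le1 andbT; apply/eqP => s0E; rewrite s0E in nMs0.
have psd w : 0 <= qform (M s0) w.
  rewrite leNgt; apply/negP => qw.
  have qc : qform (M x) w @[x --> s0] --> qform (M s0) w.
    by apply: qform_cvg => [i j|i]; [exact: Mc|exact: cvg_cst].
  have near_q : \forall x \near s0, qform (M x) w < 0 by exact: cvgr_lt _ qc _ qw.
  have /nbhs_ballP[e /= e0 he] := near_q.
  (* [s0 + d] stays in the ball, does not exceed 1, and lies beyond the supremum, so [M] is definite
     there. *)
  pose d := Num.min (e / 2) (1 - s0).
  have d0 : 0 < d by rewrite lt_min divr_gt0 //= subr_gt0.
  have /he : ball s0 e (s0 + d).
    rewrite /ball /= opprD addrA subrr add0r normrN gtr0_norm // /d gt_min.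
    by rewrite ltr_pdivrMr // mulr2n mulrDr mulr1 ltrDl e0.
  apply/negP; rewrite -leNgt.
  have [->|w0] := eqVneq w 0; first by rewrite /qform mul0mx mul0mx mxE.
  apply: ltW; move: w w0 {qw qc near_q he}; apply: contrapT => npd.
  have : B (s0 + d).
    split => //; rewrite addr_ge0 ?(ltW d0) //= -lerBrDl.
    by rewrite /d ge_min lexx orbT.
  by move=> /(sup_upper_bound supB); rewrite -/s0 gerDl leNgt d0.
move/existsNP: nMs0 => [v /not_implyP[v0 /negP]]; rewrite -leNgt => qv.
by move/eqP: v0; apply; apply: (Mker s0 s01); exact: (semidef_kernel (MT _) psd qv).
Qed.

End Forms.

(** * The angle-length Jacobian of a tetrahedron *)

Section AngleHessian.
Variable R : realType.

(** Here [o] is the cosine at the edge itself and [p], [q], [p'], [q'] are those at the four edges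
    adjacent to it. *)
Definition hess_diag (o p q p' q' : R) : R :=
  (p * q' + p' * q + o * (p * q + p' * q')) / (1 - o ^+ 2).

(* Edges are ordered 01, 02, 03, 12, 13, 23; the argument attached to the edge ab is
   the cosine of the dihedral angle at the opposite edge cd. *)
Definition hess_mx (a b c d e f : R) : 'M[R]_6 :=
  \matrix_(i, j) nth 0 (nth [::] [::
    [:: hess_diag f b d c e; - c; - b; - e; - d; 1];
    [:: - c; hess_diag e a d c f; - a; - f; 1; - d];
    [:: - b; - a; hess_diag d a e b f; 1; - f; - e];
    [:: - e; - f; 1; hess_diag c a b e f; - a; - b];
    [:: - d; 1; - f; - a; hess_diag b a c d f; - c];
    [:: 1; - d; - e; - b; - c; hess_diag a b c d e]] i) j.

Lemma ord6P (P : 'I_6 -> Prop) : P 0 -> P 1 -> P 2%:R -> P 3%:R -> P 4%:R -> P 5%:R ->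
  forall i, P i.
Proof.
move=> h0 h1 h2 h3 h4 h5 [[|[|[|[|[|[|//]]]]]] lt_i];
  [move: h0|move: h1|move: h2|move: h3|move: h4|move: h5];
  by congr P; apply: val_inj.
Qed.

Lemma sum6E (V : nmodType) (F : 'I_6 -> V) :
  \sum_i F i = F 0 + F 1 + F 2%:R + F 3%:R + F 4%:R + F 5%:R.
Proof.
rewrite !big_ord_recl big_ord0 addr0 !addrA.
by congr (F _ + F _ + F _ + F _ + F _ + F _); apply: val_inj.
Qed.

Lemma hess_mx_sym a b c d e f : (hess_mx a b c d e f)^T = hess_mx a b c d e f.
Proof. by apply/matrixP; apply: ord6P; apply: ord6P; rewrite !mxE. Qed.

Definition sym0 (u01 u02 u03 u12 u13 u23 : R) : 'M[R]_4 :=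
  \matrix_(i, j) match nat_of_ord i, nat_of_ord j with
  | 0, 1 | 1, 0 => u01 | 0, 2 | 2, 0 => u02 | 0, 3 | 3, 0 => u03
  | 1, 2 | 2, 1 => u12 | 1, 3 | 3, 1 => u13 | 2, 3 | 3, 2 => u23
  | _, _ => 0 end.

(* Rate of change of the normalised off-diagonal entry of [H], up to the factor
   [sqrt (H c c * H d d)], when [H] moves with velocity [B]. *)
Definition offdiag_rate n (H B : 'M[R]_n) c d : R :=
  B c d - H c d / 2 * (B c c / H c c + B d d / H d d).

Lemma offdiag_rateC n (H B : 'M[R]_n) c d : H^T = H -> B^T = B ->
  offdiag_rate H B c d = offdiag_rate H B d c.
Proof.
move=> HT BT; rewrite /offdiag_rate -{1}HT -{1}BT !mxE.
by rewrite [B c c / _ + _]addrC.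
Qed.

Lemma G4_sym a b c d e f : (G4 a b c d e f : 'M[R]_4)^T = G4 a b c d e f.
Proof. by apply/matrixP; apply: ord4P; apply: ord4P; rewrite !mxE. Qed.

Lemma sym0_sym a b c d e f : (sym0 a b c d e f)^T = sym0 a b c d e f.
Proof. by apply/matrixP; apply: ord4P; apply: ord4P; rewrite !mxE. Qed.

Lemma mulmx3_4E (A U : 'M[R]_4) i j : (A *m U *m A) i j =
  (A i o0 * U o0 o0 + A i o1 * U o1 o0 + A i o2 * U o2 o0 + A i o3 * U o3 o0) * A o0 j +
  (A i o0 * U o0 o1 + A i o1 * U o1 o1 + A i o2 * U o2 o1 + A i o3 * U o3 o1) * A o1 j +
  (A i o0 * U o0 o2 + A i o1 * U o1 o2 + A i o2 * U o2 o2 + A i o3 * U o3 o2) * A o2 j +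
  (A i o0 * U o0 o3 + A i o1 * U o1 o3 + A i o2 * U o2 o3 + A i o3 * U o3 o3) * A o3 j.
Proof. by rewrite !mxE sum4E !mxE !sum4E. Qed.

(** This is the origin of [hess_mx]: when a Gram matrix moves with velocity [- U], its inverse [H]
    moves with velocity [H *m U *m H], and the resulting rates of the normalised entries, divided by
    [1 - k ^+ 2], depend on [U] through [hess_mx]. *)
Lemma offdiag_rate_G4 a b c d e f v0 v1 v2 v3 v4 v5 :
  let rate := offdiag_rate (G4 a b c d e f)
    (G4 a b c d e f *m sym0 v0 v1 v2 v3 v4 v5 *m G4 a b c d e f) in
  let row (j : 'I_6) := \sum_(i < 6) [:: v0; v1; v2; v3; v4; v5]`_i * hess_mx a b c d e f i j in
  [/\ a ^+ 2 < 1, b ^+ 2 < 1 & c ^+ 2 < 1] -> [/\ d ^+ 2 < 1, e ^+ 2 < 1 & f ^+ 2 < 1] ->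
  [/\ rate o2 o3 = (1 - f ^+ 2) * row 0, rate o1 o3 = (1 - e ^+ 2) * row 1
    & rate o1 o2 = (1 - d ^+ 2) * row 2%:R] /\
  [/\ rate o0 o3 = (1 - c ^+ 2) * row 3%:R, rate o0 o2 = (1 - b ^+ 2) * row 4%:R
    & rate o0 o1 = (1 - a ^+ 2) * row 5%:R].
Proof.
move=> rate row [sa sb sc] [sd se sf].
have nz (x : R) : x ^+ 2 < 1 -> 1 - x ^+ 2 != 0 by move=> h; rewrite gt_eqF // subr_gt0.
have GE i j : G4 a b c d e f i j = match nat_of_ord i, nat_of_ord j with
  | 0, 1 | 1, 0 => - a | 0, 2 | 2, 0 => - b | 0, 3 | 3, 0 => - c
  | 1, 2 | 2, 1 => - d | 1, 3 | 3, 1 => - e | 2, 3 | 3, 2 => - f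
  | _, _ => 1 end by rewrite mxE.
have UE i j : sym0 v0 v1 v2 v3 v4 v5 i j = match nat_of_ord i, nat_of_ord j with
  | 0, 1 | 1, 0 => v0 | 0, 2 | 2, 0 => v1 | 0, 3 | 3, 0 => v2
  | 1, 2 | 2, 1 => v3 | 1, 3 | 3, 1 => v4 | 2, 3 | 3, 2 => v5
  | _, _ => 0 end by rewrite mxE.
by split; split; rewrite /rate /row /offdiag_rate sum6E ![hess_mx _ _ _ _ _ _ _ _]mxE
  !mulmx3_4E !GE !UE /= /hess_diag; field; exact: nz.
Qed.

(** A kernel vector is a variation of the lengths for which every normalised entry of [H] is
    stationary; [infinitesimal_rigidity] then applies. The diagonal of [invmx H] is nonzero because
    the vertex triples have positive [minor3]. *)
Lemma hess_mx_ker a b c d e f (v : 'rV[R]_6) : cosines_adm a b c d e f ->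
  v *m hess_mx a b c d e f = 0 -> v = 0.
Proof.
case=> detG [t0 t1 t2 t3] _ _ vM.
have [m0 [sd se sf] _] := t0; have [m1 [sb sc _] _] := t1.
have [m2 [sa _ _] _] := t2; have [m3 _ _] := t3.
pose H := G4 a b c d e f.
pose U := sym0 (v 0 0) (v 0 1) (v 0 2%:R) (v 0 3%:R) (v 0 4%:R) (v 0 5%:R).
have uH : H \in unitmx by rewrite unitmxE det_G4 unitfE oppr_eq0 gt_eqF.
have iH : invmx H = - (ndet4 a b c d e f)^-1 *: adj4 a b c d e f.
  have := mul_G4_adj4 a b c d e f; rewrite -/H => /(congr1 (fun A => invmx H *m A)).
  rewrite mulmxA mulVmx // mul1mx => ->; rewrite mul_mx_scalar scalerA.
  by rewrite mulrNN mulVf ?scale1r // gt_eqF.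
pose B := H *m U *m H.
have HT : H^T = H by exact: G4_sym.
have BT : B^T = B by rewrite /B !trmx_mul HT sym0_sym mulmxA.
have row (j : 'I_6) : \sum_(i < 6) [:: v 0 0; v 0 1; v 0 2%:R; v 0 3%:R; v 0 4%:R; v 0 5%:R]`_i *
    hess_mx a b c d e f i j = 0.
  have := congr1 (fun w : 'rV[R]_6 => w 0 j) vM; rewrite mxE [in RHS]mxE => E.
  by rewrite -[RHS]E !sum6E.
have [] := offdiag_rate_G4 (v 0 0) (v 0 1) (v 0 2%:R) (v 0 3%:R) (v 0 4%:R) (v 0 5%:R)
  (And3 sa sb sc) (And3 sd se sf).
rewrite !row !mulr0 -/H -/U -/B => -[r23 r13 r12] [r03 r02 r01].
have H1 i : H i i = 1 by move: i; apply: ord4P; rewrite mxE.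
have rate0 i j : i != j -> offdiag_rate H B i j = 0.
  by move: i j; apply: ord4P; apply: ord4P => //= _; rewrite // offdiag_rateC.
have U0 : U = 0.
  apply: (@infinitesimal_rigidity _ _ H) => //.
  - rewrite iH => i; rewrite mxE mulf_neq0 //; first by rewrite oppr_eq0 invr_eq0 gt_eqF.
    by move: i; apply: ord4P; rewrite mxE /= oppr_eq0 gt_eqF.
  - by apply: ord4P; rewrite mxE.
  move=> i j; rewrite -/B; have [->|ij] := eqVneq i j; first by rewrite H1; field.
  by have := rate0 _ _ ij; rewrite /offdiag_rate !H1 !divr1; lra.
apply/rowP; apply: ord6P; rewrite mxE.
- by have := congr1 (fun A : 'M[R]_4 => A o0 o1) U0; rewrite !mxE.
- by have := congr1 (fun A : 'M[R]_4 => A o0 o2) U0; rewrite !mxE.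
- by have := congr1 (fun A : 'M[R]_4 => A o0 o3) U0; rewrite !mxE.
- by have := congr1 (fun A : 'M[R]_4 => A o1 o2) U0; rewrite !mxE.
- by have := congr1 (fun A : 'M[R]_4 => A o1 o3) U0; rewrite !mxE.
- by have := congr1 (fun A : 'M[R]_4 => A o2 o3) U0; rewrite !mxE.
Qed.

End AngleHessian.

Section AngleHessian2.
Variable R : realType.

(** Off the diagonal each row contains one 1 and four entries [- c], so dominance requires
    [d > 1 + 4 * c], that is [6 * c ^+ 2 - 3 * c - 1 > 0]. The positive root is about 0.729, and
    [8 / 10] is a convenient rational beyond it. *)
Lemma pos_def_hess_mx_const (c : R) : 8 / 10 <= c < 1 -> pos_def (hess_mx c c c c c c).
Proof.
move=> /andP[c8 c1] v v0.
have dE : hess_diag c c c c c = 2 * c ^+ 2 / (1 - c).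
  by rewrite /hess_diag; field; nra.
set d := 2 * c ^+ 2 / (1 - c) in dE.
have d_gt : 0 < d - 1 - 4 * c.
  have -> : d - 1 - 4 * c = (6 * c ^+ 2 - 3 * c - 1) / (1 - c) by rewrite /d; field; lra.
  by rewrite divr_gt0 //; nra.
have N_gt0 : 0 < \sum_i v 0 i ^+ 2.
  rewrite lt_def sumr_ge0 ?andbT => [|i _]; last exact: sqr_ge0.
  apply: contra_neq v0 => /psumr_eq0P h; apply/rowP => i; rewrite mxE.
  by apply/eqP; rewrite -sqrf_eq0; apply/eqP/h => // *; apply: sqr_ge0.
suff : (d - 1 - 4 * c) * \sum_i v 0 i ^+ 2 <= qform (hess_mx c c c c c c) v.
  by apply: lt_le_trans; rewrite mulr_gt0.
rewrite qformE !sum6E !mxE /= !dE -subr_ge0.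
set v0' := v 0 0; set v1 := v 0 1; set v2 := v 0 2%:R; set v3 := v 0 3%:R.
set v4 := v 0 4%:R; set v5 := v 0 5%:R.
(* Diagonal dominance as a sum of squares: the three pairs of opposite edges carry the entry 1, the
   twelve adjacent pairs the entry [- c]. *)
rewrite [X in 0 <= X](_ : _ = (v0' + v5) ^+ 2 + (v1 + v4) ^+ 2 + (v2 + v3) ^+ 2
  + c * ((v0' - v1) ^+ 2 + (v0' - v2) ^+ 2 + (v0' - v3) ^+ 2 + (v0' - v4) ^+ 2
       + (v5 - v1) ^+ 2 + (v5 - v2) ^+ 2 + (v5 - v3) ^+ 2 + (v5 - v4) ^+ 2
       + (v1 - v2) ^+ 2 + (v1 - v3) ^+ 2 + (v4 - v2) ^+ 2 + (v4 - v3) ^+ 2)); last by ring.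
have c0 : 0 <= c by lra.
by repeat first [exact: c0 | exact: sqr_ge0 | apply: addr_ge0 | apply: mulr_ge0].
Qed.

Lemma hess_diag_cvg (T : Type) (F : set_system T) {FF : Filter F}
    (o p q p' q' : T -> R) (o0 p0 q0 p0' q0' : R) : 1 - o0 ^+ 2 != 0 ->
  o x @[x --> F] --> o0 -> p x @[x --> F] --> p0 -> q x @[x --> F] --> q0 ->
  p' x @[x --> F] --> p0' -> q' x @[x --> F] --> q0' ->
  hess_diag (o x) (p x) (q x) (p' x) (q' x) @[x --> F] -->
    hess_diag o0 p0 q0 p0' q0'.
Proof.
move=> nz ho hp hq hp' hq'; rewrite /hess_diag.
apply: cvgM; first by apply: cvgD; [apply: cvgD|]; do ?[apply: cvgM => //]; apply: cvgD; apply: cvgM.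
apply: cvgV => //; apply: cvgB; first exact: cvg_cst.
exact: cvg_exprn.
Qed.

Lemma hess_mx_cvg (T : Type) (F : set_system T) {FF : Filter F}
    (a b c d e f : T -> R) (a0 b0 c0 d0 e0 f0 : R) :
  1 - a0 ^+ 2 != 0 -> 1 - b0 ^+ 2 != 0 -> 1 - c0 ^+ 2 != 0 ->
  1 - d0 ^+ 2 != 0 -> 1 - e0 ^+ 2 != 0 -> 1 - f0 ^+ 2 != 0 ->
  a x @[x --> F] --> a0 -> b x @[x --> F] --> b0 -> c x @[x --> F] --> c0 ->
  d x @[x --> F] --> d0 -> e x @[x --> F] --> e0 -> f x @[x --> F] --> f0 ->
  forall i j, hess_mx (a x) (b x) (c x) (d x) (e x) (f x) i j @[x --> F] -->
    hess_mx a0 b0 c0 d0 e0 f0 i j.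
Proof.
move=> na nb nc nd ne nf ha hb hc hd he hf.
apply: ord6P; apply: ord6P; under eq_cvg do rewrite mxE /=;
  rewrite mxE /=; do ?[exact: cvg_cst|exact: cvgN|exact: hess_diag_cvg].
Qed.

Lemma pos_def_hess_mx (a b c d e f : R) :
  cosines_adm a b c d e f -> pos_def (hess_mx a b c d e f).
Proof.
move=> adm.
have [_ [[_ [sd se sf] _] [_ [sb sc _] _] [_ [sa _ _] _] _] _ _] := adm.
have lt1 (x : R) : x ^+ 2 < 1 -> x < 1 by move=> h; rewrite ltNge; apply/negP => ?; nra.
have [m [[am bm cm] [dm em fm] [m8 m1]]] : exists m, [/\ [/\ a <= m, b <= m & c <= m],
    [/\ d <= m, e <= m & f <= m] & 8 / 10 <= m /\ m < 1].
  (* Above all six cosines, so that the path to [m] only raises them, and at least [8 / 10], so that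
     the regular case covers its end. *)
  exists (Num.max (8 / 10) (Num.max a (Num.max b (Num.max c (Num.max d (Num.max e f)))))).
  split; [split|split|split]; try by rewrite !le_max lexx ?orbT.
  rewrite !gt_max (lt1 a) // (lt1 b) // (lt1 c) // (lt1 d) // (lt1 e) // (lt1 f) //.
  by rewrite !andbT; lra.
pose k x s := x + s * (m - x).
have kle x s : x ^+ 2 < 1 -> x <= m -> 0 <= s <= 1 -> x <= k x s < 1.
  by move=> /lt1 x1 xm /andP[s0 s1]; rewrite /k; apply/andP; split; nra.
have admk s : 0 <= s <= 1 -> cosines_adm (k a s) (k b s) (k c s) (k d s) (k e s) (k f s).
  by move=> s01; apply: (cosines_adm_le _ _ _ _ _ _ adm); apply: kle.
have kc x s : k x t @[t --> s] --> k x s.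
  by apply: cvgD; [exact: cvg_cst|apply: cvgM; [exact: cvg_id|exact: cvg_cst]].
have k0 x : k x 0 = x by rewrite /k mul0r addr0.
have k1 x : k x 1 = m by rewrite /k; ring.
have nz (x : R) : x ^+ 2 < 1 -> 1 - x ^+ 2 != 0 by move=> h; rewrite gt_eqF // subr_gt0.
rewrite -(k0 a) -(k0 b) -(k0 c) -(k0 d) -(k0 e) -(k0 f).
apply: (@pos_def_path _ _ (fun s => hess_mx (k a s) (k b s) (k c s) (k d s) (k e s) (k f s))).
- move=> s /admk[_ [[_ [td te tf] _] [_ [tb tc _] _] [_ [ta _ _] _] _] _ _] i j.
  by apply: hess_mx_cvg; try exact: nz; exact: kc.
- by move=> s; exact: hess_mx_sym.
- by move=> s /admk h v; exact: hess_mx_ker.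
- by rewrite !k1; apply: pos_def_hess_mx_const; rewrite m8.
Qed.
End AngleHessian2.

(** * From edge lengths to cosines of the dihedral angles *)

Section GramCosines.
Variable R : rcfType.

(** The conditions of [triple_adm] with denominators cleared, so that the polynomial identities for
    the adjugate apply directly. *)
Lemma triple_adm_scaled (hb hc hd wbc wbd wcd : R) :
  0 < hb -> 0 < hc -> 0 < hd ->
  0 < wbc ^+ 2 * hd ^+ 2 + wbd ^+ 2 * hc ^+ 2 + wcd ^+ 2 * hb ^+ 2
      + 2 * wbc * wbd * wcd - hb ^+ 2 * hc ^+ 2 * hd ^+ 2 ->
  wbc ^+ 2 < hb ^+ 2 * hc ^+ 2 -> wbd ^+ 2 < hb ^+ 2 * hd ^+ 2 ->
  wcd ^+ 2 < hc ^+ 2 * hd ^+ 2 ->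
  0 < hd ^+ 2 * wbc + wbd * wcd -> 0 < hc ^+ 2 * wbd + wbc * wcd ->
  0 < hb ^+ 2 * wcd + wbc * wbd ->
  triple_adm (wbc / (hb * hc)) (wbd / (hb * hd)) (wcd / (hc * hd)).
Proof.
move=> b0 c0 d0 m s1 s2 s3 a1 a2 a3.
have nzb : hb != 0 by rewrite gt_eqF.
have nzc : hc != 0 by rewrite gt_eqF.
have nzd : hd != 0 by rewrite gt_eqF.
have sq (w x y : R) : 0 < x -> 0 < y -> w ^+ 2 < x ^+ 2 * y ^+ 2 -> (w / (x * y)) ^+ 2 < 1.
  by move=> x0 y0 h; rewrite expr_div_n ltr_pdivrMr ?exprn_gt0 ?mulr_gt0 // mul1r exprMn.
split; [|by split; exact: sq|split].
- have -> : minor3 (wbc / (hb * hc)) (wbd / (hb * hd)) (wcd / (hc * hd)) =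
    (wbc ^+ 2 * hd ^+ 2 + wbd ^+ 2 * hc ^+ 2 + wcd ^+ 2 * hb ^+ 2
      + 2 * wbc * wbd * wcd - hb ^+ 2 * hc ^+ 2 * hd ^+ 2) / (hb * hc * hd) ^+ 2.
    by rewrite /minor3; field; rewrite ?nzb ?nzc ?nzd.
  by rewrite divr_gt0 // exprn_gt0 // !mulr_gt0.
- have -> : wbc / (hb * hc) + wbd / (hb * hd) * (wcd / (hc * hd)) =
    (hd ^+ 2 * wbc + wbd * wcd) / (hb * hc * hd ^+ 2) by field; rewrite ?nzb ?nzc ?nzd.
  by rewrite divr_gt0 // ?mulr_gt0 ?exprn_gt0.
- have -> : wbd / (hb * hd) + wbc / (hb * hc) * (wcd / (hc * hd)) =
    (hc ^+ 2 * wbd + wbc * wcd) / (hb * hd * hc ^+ 2) by field; rewrite ?nzb ?nzc ?nzd.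
  by rewrite divr_gt0 // ?mulr_gt0 ?exprn_gt0.
- have -> : wcd / (hc * hd) + wbc / (hb * hc) * (wbd / (hb * hd)) =
    (hb ^+ 2 * wcd + wbc * wbd) / (hc * hd * hb ^+ 2) by field; rewrite ?nzb ?nzc ?nzd.
  by rewrite divr_gt0 // ?mulr_gt0 ?exprn_gt0.
Qed.

Section Adjugate.
Variables a b c d e f : R.
Let p0 := minor3 d e f. Let p1 := minor3 b c f.
Let p2 := minor3 a c e. Let p3 := minor3 a b d.
Let w01 := cof_off a f b d c e. Let w02 := cof_off b e a d c f.
Let w03 := cof_off c d a e b f. Let w12 := cof_off d c a b e f.
Let w13 := cof_off e b a c d f. Let w23 := cof_off f a b c d e.
Let n := ndet4 a b c d e f.

Ltac poly := rewrite /w01 /w02 /w03 /w12 /w13 /w23 /p0 /p1 /p2 /p3 /n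
  /cof_off /minor3 /ndet4; ring.

(** Here and in the next three lemmas: by Jacobi, a 2x2 minor of the adjugate is the determinant
    times the complementary minor of the matrix, and a 3x3 minor is the squared determinant times an
    entry. *)
Lemma adj_minor2 : [/\ p0 * p1 - w01 ^+ 2 = n * (f ^+ 2 - 1),
   p0 * p2 - w02 ^+ 2 = n * (e ^+ 2 - 1) & p0 * p3 - w03 ^+ 2 = n * (d ^+ 2 - 1)] /\
  [/\ p1 * p2 - w12 ^+ 2 = n * (c ^+ 2 - 1),
   p1 * p3 - w13 ^+ 2 = n * (b ^+ 2 - 1) & p2 * p3 - w23 ^+ 2 = n * (a ^+ 2 - 1)].
Proof. by split; split; poly. Qed.

Lemma adj_minor2_off :
  [/\ [/\ p3 * w12 + w13 * w23 = n * (d + a * b),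
      p2 * w13 + w12 * w23 = n * (e + a * c) &
      p1 * w23 + w12 * w13 = n * (f + b * c)],
  [/\ p3 * w02 + w03 * w23 = n * (b + a * d),
      p2 * w03 + w02 * w23 = n * (c + a * e) &
      p0 * w23 + w02 * w03 = n * (f + d * e)],
  [/\ p3 * w01 + w03 * w13 = n * (a + b * d),
      p1 * w03 + w01 * w13 = n * (c + b * f) &
      p0 * w13 + w01 * w03 = n * (e + d * f)] &
  [/\ p2 * w01 + w02 * w12 = n * (a + c * e),
      p1 * w02 + w01 * w12 = n * (b + c * f) &
      p0 * w12 + w01 * w02 = n * (d + e * f)]].
Proof. by split; split; poly. Qed.

Lemma adj_minor3 :
  [/\ w12 ^+ 2 * p3 + w13 ^+ 2 * p2 + w23 ^+ 2 * p1 + 2 * w12 * w13 * w23 - p1 * p2 * p3 = n ^+ 2,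
      w02 ^+ 2 * p3 + w03 ^+ 2 * p2 + w23 ^+ 2 * p0 + 2 * w02 * w03 * w23 - p0 * p2 * p3 = n ^+ 2,
      w01 ^+ 2 * p3 + w03 ^+ 2 * p1 + w13 ^+ 2 * p0 + 2 * w01 * w03 * w13 - p0 * p1 * p3 = n ^+ 2 &
      w01 ^+ 2 * p2 + w02 ^+ 2 * p1 + w12 ^+ 2 * p0 + 2 * w01 * w02 * w12 - p0 * p1 * p2 = n ^+ 2].
Proof. by split; poly. Qed.

Lemma adj_cof_off :
  [/\ w01 * (p2 * p3 - w23 ^+ 2) + w02 * w12 * p3 + w03 * w13 * p2
        + w23 * (w02 * w13 + w03 * w12) = n ^+ 2 * a,
      w02 * (p1 * p3 - w13 ^+ 2) + w01 * w12 * p3 + w03 * w23 * p1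
        + w13 * (w01 * w23 + w03 * w12) = n ^+ 2 * b &
      w03 * (p1 * p2 - w12 ^+ 2) + w01 * w13 * p2 + w02 * w23 * p1
        + w12 * (w01 * w23 + w02 * w13) = n ^+ 2 * c] /\
  [/\ w12 * (p0 * p3 - w03 ^+ 2) + w01 * w02 * p3 + w13 * w23 * p0
        + w03 * (w01 * w23 + w13 * w02) = n ^+ 2 * d,
      w13 * (p0 * p2 - w02 ^+ 2) + w01 * w03 * p2 + w12 * w23 * p0
        + w02 * (w01 * w23 + w12 * w03) = n ^+ 2 * e &
      w23 * (p0 * p1 - w01 ^+ 2) + w02 * w03 * p1 + w12 * w13 * p0
        + w01 * (w02 * w13 + w12 * w03) = n ^+ 2 * f].
Proof. by split; split; poly. Qed.

(** Each condition on the cosines turns into a positive multiple of an expression in the entries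
    [a], ..., [f], which is positive because these exceed 1. *)
Lemma cosines_adm_adj (h0 h1 h2 h3 : R) :
  1 < a -> 1 < b -> 1 < c -> 1 < d -> 1 < e -> 1 < f -> 0 < n ->
  0 < h0 -> 0 < h1 -> 0 < h2 -> 0 < h3 ->
  h0 ^+ 2 = p0 -> h1 ^+ 2 = p1 -> h2 ^+ 2 = p2 -> h3 ^+ 2 = p3 ->
  cosines_adm (w01 / (h0 * h1)) (w02 / (h0 * h2)) (w03 / (h0 * h3))
              (w12 / (h1 * h2)) (w13 / (h1 * h3)) (w23 / (h2 * h3)).
Proof.
have sqr1 (x : R) : 1 < x -> 0 < x ^+ 2 - 1 by move=> ?; nra.
have xyz (x y z : R) : 1 < x -> 1 < y -> 1 < z -> 0 < x + y * z.
  by move=> *; rewrite addr_gt0 ?mulr_gt0 //; lra.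
move=> a1 b1 c1 d1 e1 f1 n0 h00 h10 h20 h30 q0 q1 q2 q3.
have [[m01 m02 m03] [m12 m13 m23]] := adj_minor2.
have [[l1 l2 l3] [l4 l5 l6] [l7 l8 l9] [l10 l11 l12]] := adj_minor2_off.
have [t0 t1 t2 t3] := adj_minor3.
have [[c01 c02 c03] [c12 c13 c23]] := adj_cof_off.
have nz0 : h0 != 0 by rewrite gt_eqF.
have nz1 : h1 != 0 by rewrite gt_eqF.
have nz2 : h2 != 0 by rewrite gt_eqF.
have nz3 : h3 != 0 by rewrite gt_eqF.
have sq (p w x : R) : 1 < x -> p - w ^+ 2 = n * (x ^+ 2 - 1) -> w ^+ 2 < p.
  by move=> x1 E; rewrite -subr_gt0 E mulr_gt0 // sqr1.
have mp (x y z : R) : 1 < x -> 1 < y -> 1 < z -> 0 < n * (x + y * z).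
  by move=> *; rewrite mulr_gt0 // xyz.
have n2 : 0 < n ^+ 2 by rewrite exprn_gt0.
have n2x x : 1 < x -> 0 < n ^+ 2 * x by move=> x1; rewrite mulr_gt0 // (lt_trans ltr01).
have T0 : triple_adm (w12 / (h1 * h2)) (w13 / (h1 * h3)) (w23 / (h2 * h3)).
  by apply: triple_adm_scaled; rewrite // ?q1 ?q2 ?q3 ?l1 ?l2 ?l3 ?t0 ?n2 ?mp //;
    [exact: (sq _ _ _ c1 m12)|exact: (sq _ _ _ b1 m13)|exact: (sq _ _ _ a1 m23)].
have T1 : triple_adm (w02 / (h0 * h2)) (w03 / (h0 * h3)) (w23 / (h2 * h3)).
  by apply: triple_adm_scaled; rewrite // ?q0 ?q2 ?q3 ?l4 ?l5 ?l6 ?t1 ?n2 ?mp //;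
    [exact: (sq _ _ _ e1 m02)|exact: (sq _ _ _ d1 m03)|exact: (sq _ _ _ a1 m23)].
have T2 : triple_adm (w01 / (h0 * h1)) (w03 / (h0 * h3)) (w13 / (h1 * h3)).
  by apply: triple_adm_scaled; rewrite // ?q0 ?q1 ?q3 ?l7 ?l8 ?l9 ?t2 ?n2 ?mp //;
    [exact: (sq _ _ _ f1 m01)|exact: (sq _ _ _ d1 m03)|exact: (sq _ _ _ b1 m13)].
have T3 : triple_adm (w01 / (h0 * h1)) (w02 / (h0 * h2)) (w12 / (h1 * h2)).
  by apply: triple_adm_scaled; rewrite // ?q0 ?q1 ?q2 ?l10 ?l11 ?l12 ?t3 ?n2 ?mp //;
    [exact: (sq _ _ _ f1 m01)|exact: (sq _ _ _ e1 m02)|exact: (sq _ _ _ c1 m12)].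
have cofE (ha hb hc hd wab wcd wac wbc wad wbd : R) :
    ha != 0 -> hb != 0 -> hc != 0 -> hd != 0 ->
    cof_off (wab / (ha * hb)) (wcd / (hc * hd)) (wac / (ha * hc)) (wbc / (hb * hc))
      (wad / (ha * hd)) (wbd / (hb * hd)) =
    (wab * (hc ^+ 2 * hd ^+ 2 - wcd ^+ 2) + wac * wbc * hd ^+ 2 + wad * wbd * hc ^+ 2
      + wcd * (wac * wbd + wad * wbc)) / (ha * hb * hc ^+ 2 * hd ^+ 2).
  by move=> za zb zc zd; rewrite /cof_off; field; rewrite ?za ?zb ?zc ?zd.
have flip (x y w : R) : w / (x * y) = w / (y * x) by congr (_ / _); exact: mulrC.
have C01 := cofE h0 h1 h2 h3 w01 w23 w02 w12 w03 w13 nz0 nz1 nz2 nz3.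
have C02 := cofE h0 h2 h1 h3 w02 w13 w01 w12 w03 w23 nz0 nz2 nz1 nz3.
have C03 := cofE h0 h3 h1 h2 w03 w12 w01 w13 w02 w23 nz0 nz3 nz1 nz2.
have C12 := cofE h1 h2 h0 h3 w12 w03 w01 w02 w13 w23 nz1 nz2 nz0 nz3.
have C13 := cofE h1 h3 h0 h2 w13 w02 w01 w03 w12 w23 nz1 nz3 nz0 nz2.
have C23 := cofE h2 h3 h0 h1 w23 w01 w02 w03 w12 w13 nz2 nz3 nz0 nz1.
rewrite ?(flip h2 h1) ?(flip h3 h1) ?(flip h3 h2) ?(flip h1 h0) ?(flip h2 h0) ?(flip h3 h0)
  ?q0 ?q1 ?q2 ?q3 in C01 C02 C03 C12 C13 C23.
rewrite c01 in C01; rewrite c02 in C02; rewrite c03 in C03.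
rewrite c12 in C12; rewrite c13 in C13; rewrite c23 in C23.
have hp (x y z t : R) : 0 < x -> 0 < y -> 0 < z -> 0 < t -> 0 < x * y * z * t.
  by move=> *; rewrite !mulr_gt0.
have p0_gt0 : 0 < p0 by rewrite -q0 exprn_gt0.
have p1_gt0 : 0 < p1 by rewrite -q1 exprn_gt0.
have p2_gt0 : 0 < p2 by rewrite -q2 exprn_gt0.
have p3_gt0 : 0 < p3 by rewrite -q3 exprn_gt0.
split; [|by split|split|split]; last first.
- by rewrite C23 divr_gt0 ?n2x ?hp.
- by rewrite C13 divr_gt0 ?n2x ?hp.
- by rewrite C12 divr_gt0 ?n2x ?hp.
- by rewrite C03 divr_gt0 ?n2x ?hp.
- by rewrite C02 divr_gt0 ?n2x ?hp.
- by rewrite C01 divr_gt0 ?n2x ?hp.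
(* The remaining condition concerns the determinant. Instead of being expanded, it is solved for in
   Jacobi's identity, whose other terms are known by now. *)
have := jacobi_off (w01 / (h0 * h1)) (w02 / (h0 * h2)) (w03 / (h0 * h3))
              (w12 / (h1 * h2)) (w13 / (h1 * h3)) (w23 / (h2 * h3)).
set N := ndet4 _ _ _ _ _ _; rewrite C01.
have mE (hb hc hd wbc wbd wcd : R) : hb != 0 -> hc != 0 -> hd != 0 ->
    minor3 (wbc / (hb * hc)) (wbd / (hb * hd)) (wcd / (hc * hd)) =
    (wbc ^+ 2 * hd ^+ 2 + wbd ^+ 2 * hc ^+ 2 + wcd ^+ 2 * hb ^+ 2
      + 2 * wbc * wbd * wcd - hb ^+ 2 * hc ^+ 2 * hd ^+ 2) / (hb ^+ 2 * hc ^+ 2 * hd ^+ 2).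
  by move=> zb zc zd; rewrite /minor3; field; rewrite ?zb ?zc ?zd.
rewrite !mE // q0 q1 q2 q3 t0 t1 => E.
have [_ [_ _ s23] _] := T0.
have s : 0 < 1 - (w23 / (h2 * h3)) ^+ 2 by rewrite subr_gt0.
rewrite -(pmulr_rgt0 _ s).
have -> : (1 - (w23 / (h2 * h3)) ^+ 2) * N =
   n ^+ 4 * (a ^+ 2 - 1) / (p0 * p1 * (p2 * p3) ^+ 2).
  have -> : (1 - (w23 / (h2 * h3)) ^+ 2) * N =
   (n ^+ 2 * a / (h0 * h1 * p2 * p3)) ^+ 2
      - n ^+ 2 / (p1 * p2 * p3) * (n ^+ 2 / (p0 * p2 * p3)).
    by rewrite E; ring.
  rewrite -q0 -q1 -q2 -q3; field.
  by rewrite nz0 nz1 nz2 nz3.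
by rewrite divr_gt0 ?mulr_gt0 ?exprn_gt0 ?mulr_gt0 // sqr1.
Qed.
End Adjugate.
End GramCosines.

Lemma enum_ord4 : enum 'I_4 = [:: o0; o1; o2; o3].
Proof. by apply: (inj_map val_inj); rewrite val_enum_ord. Qed.

Lemma oppC (a b : 'I_4) : opp1 a b = opp1 b a /\ opp2 a b = opp2 b a.
Proof. by move: a b; apply: ord4P; apply: ord4P; rewrite /opp1 /opp2 enum_ord4. Qed.

Lemma oppE :
  [/\ opp1 o0 o1 = o2, opp1 o0 o2 = o1 & opp1 o0 o3 = o1] /\
  [/\ opp1 o1 o2 = o0, opp1 o1 o3 = o0 & opp1 o2 o3 = o0] /\
  [/\ opp2 o0 o1 = o3, opp2 o0 o2 = o3 & opp2 o0 o3 = o2] /\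
  [/\ opp2 o1 o2 = o3, opp2 o1 o3 = o2 & opp2 o2 o3 = o1].
Proof. by rewrite /opp1 /opp2 enum_ord4. Qed.

(** * The angle-length form in terms of the Gram matrix *)

Section TetForm.
Variable R : realType.

Definition gram (X : 'I_4 -> 'I_4 -> R) : 'M[R]_4 :=
  \matrix_(a, b) (if a == b then 1 else - X a b).

Lemma gram_G4 X : (forall a b, X a b = X b a) ->
  gram X = G4 (X o0 o1) (X o0 o2) (X o0 o3) (X o1 o2) (X o1 o3) (X o2 o3).
Proof.
by move=> XC; apply/matrixP; apply: ord4P; apply: ord4P; rewrite !mxE //= XC.
Qed.

(** With [X a b = cosh (L a b) > 1] off the diagonal, a negative determinant amounts to signature
    (3, 1). *)
Definition gram_adm (X : 'I_4 -> 'I_4 -> R) : Prop :=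
  [/\ forall a b, X a b = X b a, forall a b, a != b -> 1 < X a b &
      \det (gram X) < 0].

Definition minor2 (H : 'M[R]_4) c d : R := H c c * H d d - H c d ^+ 2.

(** With [u] the velocity of the [cosh l], this is the sum of [dbeta dl] over ordered pairs, times
    the root of minus the Gram determinant. Taking out that common factor leaves no square root. *)
Definition tet_form (H u : 'M[R]_4) : R :=
  \sum_a \sum_(b | b != a) u a b *
    (offdiag_rate H (H *m u *m H) (opp1 a b) (opp2 a b) /
     minor2 H (opp1 a b) (opp2 a b)).

Section Scaling.
Variables (n : nat) (H K u U : 'M[R]_n) (h : 'I_n -> R) (s : R).
Hypothesis h0 : forall i, h i != 0.
Hypothesis s0 : s != 0.
Hypothesis HE : forall i j, H i j = s * h i * h j * K i j.
Hypothesis uE : forall i j, u i j = U i j / (h i * h j).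

Lemma conj_scale i j : (H *m u *m H) i j = s ^+ 2 * h i * h j * (K *m U *m K) i j.
Proof.
rewrite !mxE mulr_sumr; apply: eq_bigr => k _; rewrite !mxE !mulr_suml mulr_sumr.
apply: eq_bigr => l _; rewrite !HE uE; field.
by rewrite !h0.
Qed.

Lemma offdiag_rate_scale c d : K c c != 0 -> K d d != 0 ->
  offdiag_rate H (H *m u *m H) c d =
  s ^+ 2 * h c * h d * offdiag_rate K (K *m U *m K) c d.
Proof.
move=> Kc Kd; rewrite /offdiag_rate !conj_scale !HE; field.
by rewrite !h0 Kc Kd s0.
Qed.
End Scaling.

Lemma inv_gram X : gram_adm X ->
  invmx (gram X) = - (- \det (gram X))^-1 *:
   adj4 (X o0 o1) (X o0 o2) (X o0 o3) (X o1 o2) (X o1 o3) (X o2 o3).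
Proof.
case=> XC _ det; have n0 : \det (gram X) != 0 by rewrite lt_eqF.
have uG : gram X \in unitmx by rewrite unitmxE unitfE.
have := mul_G4_adj4 (X o0 o1) (X o0 o2) (X o0 o3) (X o1 o2) (X o1 o3) (X o2 o3).
rewrite -gram_G4 // -det_G4 -gram_G4 // => /(congr1 (fun A => invmx (gram X) *m A)).
rewrite mulmxA mulVmx // mul1mx => ->; rewrite mul_mx_scalar scalerA.
by rewrite invrN opprK mulVf // scale1r.
Qed.

Lemma minor3_gt0 (x y z : R) : 1 < x -> 1 < y -> 1 < z -> 0 < minor3 x y z.
Proof.
move=> x1 y1 z1; rewrite /minor3.
have : 0 < x * y * z by rewrite !mulr_gt0 //; lra.
by nra.
Qed.

Lemma inv_gram_diag X i : gram_adm X -> 0 < invmx (gram X) i i.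
Proof.
move=> adm; rewrite inv_gram //; case: adm => XC X1 det; rewrite mxE mulNr oppr_gt0.
rewrite pmulr_rlt0 ?invr_gt0 ?oppr_gt0 //.
by move: i; apply: ord4P; rewrite mxE /= oppr_lt0 minor3_gt0 ?X1.
Qed.

(** Jacobi's identity again. The right-hand side is [sinh l ^+ 2] up to a factor common to all edges
    of the tetrahedron, which is what makes [d beta / d l] symmetric. *)
Lemma inv_gram_minor X a b : gram_adm X -> a != b ->
  minor2 (invmx (gram X)) (opp1 a b) (opp2 a b) = (X a b ^+ 2 - 1) / - \det (gram X).
Proof.
move=> adm ab; rewrite /minor2 inv_gram //; case: adm => XC X1 det.
have n0 : \det (gram X) != 0 by rewrite lt_eqF.
have [[p01 p02 p03] [[p12 p13 p23] [[q01 q02 q03] [q12 q13 q23]]]] := oppE.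
have [] := adj_minor2 (X o0 o1) (X o0 o2) (X o0 o3) (X o1 o2) (X o1 o3) (X o2 o3).
have nE : ndet4 (X o0 o1) (X o0 o2) (X o0 o3) (X o1 o2) (X o1 o3) (X o2 o3) = - \det (gram X).
  by rewrite gram_G4 // det_G4 opprK.
rewrite nE; set n := - \det (gram X); have nn : n != 0 by rewrite oppr_eq0.
move=> [m23 m13 m12] [m03 m02 m01].
have key P Q w x : P * Q - w ^+ 2 = n * (x ^+ 2 - 1) ->
    (- n^-1 * - P) * (- n^-1 * - Q) - (- n^-1 * w) ^+ 2 = (x ^+ 2 - 1) / n.
  move=> E; have -> : x ^+ 2 - 1 = (P * Q - w ^+ 2) / n by rewrite E; field.
  by field.
move: a b ab; apply: ord4P; apply: ord4P => //= _; rewrite ?(oppC o1 o0).1 ?(oppC o1 o0).2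
  ?(oppC o2 o0).1 ?(oppC o2 o0).2 ?(oppC o3 o0).1 ?(oppC o3 o0).2 ?(oppC o2 o1).1
  ?(oppC o2 o1).2 ?(oppC o3 o1).1 ?(oppC o3 o1).2 ?(oppC o3 o2).1 ?(oppC o3 o2).2
  ?p01 ?p02 ?p03 ?p12 ?p13 ?p23 ?q01 ?q02 ?q03 ?q12 ?q13 ?q23 !mxE /=;
  rewrite ?(XC o1 o0) ?(XC o2 o0) ?(XC o3 o0) ?(XC o2 o1) ?(XC o3 o1) ?(XC o3 o2);
  exact: key.
Qed.

(** Dividing [H] by the roots [h] of its scaled diagonal produces the Gram matrix [K] of the faces;
    the inverse scaling of [u] turns the form into that of [hess_mx] at the cosines. *)
Lemma tet_form_gt0 X (u : 'M[R]_4) : gram_adm X ->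
  u^T = u -> (forall i, u i i = 0) -> u != 0 -> 0 < tet_form (invmx (gram X)) u.
Proof.
move=> adm uT u0 unz; set H := invmx (gram X).
have [XC X1 det] := adm.
set a := X o0 o1; set b := X o0 o2; set c := X o0 o3; set d := X o1 o2.
set e := X o1 o3; set f := X o2 o3.
have [n nd] : exists n, n = - \det (gram X) by eexists.
have n0 : 0 < n by rewrite nd oppr_gt0.
have nE : n = ndet4 a b c d e f by rewrite nd gram_G4 // det_G4 opprK.
have HE := inv_gram adm; rewrite -/H -nd -/a -/b -/c -/d -/e -/f in HE.
pose h (i : 'I_4) : R := Num.sqrt (n * H i i).
have h_gt0 i : 0 < h i by rewrite sqrtr_gt0 mulr_gt0 // inv_gram_diag.
have hnz i : h i != 0 by rewrite gt_eqF.
have h2 i : h i ^+ 2 = n * H i i.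
  by rewrite sqr_sqrtr // mulr_ge0 ?ltW // inv_gram_diag.
have nnz : n != 0 by rewrite gt_eqF.
have nH i j : n * H i j = - adj4 a b c d e f i j.
  by rewrite HE mxE mulNr mulrN mulrA mulfV // mul1r.
have hE : [/\ h o0 ^+ 2 = minor3 d e f, h o1 ^+ 2 = minor3 b c f,
    h o2 ^+ 2 = minor3 a c e & h o3 ^+ 2 = minor3 a b d].
  by rewrite !h2 !nH !mxE /= !opprK.
have [hE0 hE1 hE2 hE3] := hE.
have n0' := n0; rewrite nE in n0'.
have ak := cosines_adm_adj (X1 o0 o1 isT) (X1 o0 o2 isT) (X1 o0 o3 isT) (X1 o1 o2 isT)
  (X1 o1 o3 isT) (X1 o2 o3 isT) n0' (h_gt0 o0) (h_gt0 o1) (h_gt0 o2) (h_gt0 o3) hE0 hE1 hE2 hE3.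
rewrite -/a -/b -/c -/d -/e -/f in ak.
move: ak; set k01 := cof_off a _ _ _ _ _ / _; set k02 := cof_off b _ _ _ _ _ / _.
set k03 := cof_off c _ _ _ _ _ / _; set k12 := cof_off d _ _ _ _ _ / _.
set k13 := cof_off e _ _ _ _ _ / _; set k23 := cof_off f _ _ _ _ _ / _ => ak.
pose K := G4 k01 k02 k03 k12 k13 k23.
pose v : 'rV[R]_6 := \row_j [:: u o0 o1 * (h o0 * h o1); u o0 o2 * (h o0 * h o2);
  u o0 o3 * (h o0 * h o3); u o1 o2 * (h o1 * h o2); u o1 o3 * (h o1 * h o3);
  u o2 o3 * (h o2 * h o3)]`_j.
pose U := sym0 (u o0 o1 * (h o0 * h o1)) (u o0 o2 * (h o0 * h o2))
  (u o0 o3 * (h o0 * h o3)) (u o1 o2 * (h o1 * h o2)) (u o1 o3 * (h o1 * h o3))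
  (u o2 o3 * (h o2 * h o3)).
have uC i j : u i j = u j i by rewrite -{1}uT mxE.
have uU i j : u i j = U i j / (h i * h j).
  by move: i j; apply: ord4P; apply: ord4P; rewrite !mxE /= ?u0 ?mul0r // 1?uC; field;
     rewrite !hnz.
have HK i j : H i j = n^-1 * h i * h j * K i j.
  apply: (mulfI nnz); rewrite nH.
  move: i j; apply: ord4P; apply: ord4P; rewrite !mxE /= -?hE0 -?hE1 -?hE2 -?hE3
    /k01 /k02 /k03 /k12 /k13 /k23; field; rewrite ?nnz ?hnz //.
have Kd i : K i i = 1 by move: i; apply: ord4P; rewrite mxE.
have KT : K^T = K by exact: G4_sym.
have [_ [[_ [s12 s13 s23] _] [_ [s02 s03 _] _] [_ [s01 _ _] _] _] _ _] := ak.
have := offdiag_rate_G4 (u o0 o1 * (h o0 * h o1)) (u o0 o2 * (h o0 * h o2))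
  (u o0 o3 * (h o0 * h o3)) (u o1 o2 * (h o1 * h o2)) (u o1 o3 * (h o1 * h o3))
  (u o2 o3 * (h o2 * h o3)) (And3 s01 s02 s03) (And3 s12 s13 s23).
rewrite -/K -/U => -[[r23 r13 r12] [r03 r02 r01]].
pose row (j : 'I_6) := \sum_i v 0 i * hess_mx k01 k02 k03 k12 k13 k23 i j.
have rowE (j : 'I_6) : \sum_(i < 6) [:: u o0 o1 * (h o0 * h o1); u o0 o2 * (h o0 * h o2);
  u o0 o3 * (h o0 * h o3); u o1 o2 * (h o1 * h o2); u o1 o3 * (h o1 * h o3);
  u o2 o3 * (h o2 * h o3)]`_i * hess_mx k01 k02 k03 k12 k13 k23 i j = row j.
  by apply: eq_bigr => i _; rewrite [v 0 i]mxE.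
rewrite !rowE in r23 r13 r12 r03 r02 r01.
pose hh := h o0 * h o1 * h o2 * h o3.
have hh0 : 0 < hh by rewrite /hh !mulr_gt0.
pose t i j := u i j * (offdiag_rate H (H *m u *m H) (opp1 i j) (opp2 i j) /
     minor2 H (opp1 i j) (opp2 i j)).
have tC i j : t i j = t j i by rewrite /t uC (oppC i j).1 (oppC i j).2.
have tE i j (y : R) (k : R) : k ^+ 2 < 1 ->
   offdiag_rate K (K *m U *m K) (opp1 i j) (opp2 i j) = (1 - k ^+ 2) * y ->
   K (opp1 i j) (opp2 i j) = - k -> h i * h j * (h (opp1 i j) * h (opp2 i j)) = hh ->
   t i j = hh^-1 * (U i j * y).
  move=> k1 ry Kk hhE; rewrite /t (@offdiag_rate_scale _ H K u U h n^-1) ?Kd ?oner_eq0 ?invr_eq0 //.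
  rewrite /minor2 !HK !Kd uU Kk ry -hhE; field.
  rewrite ?nnz ?hnz /= ?andbT.
  rewrite [X in X != 0](_ : _ = (h (opp1 i j) * h (opp2 i j)) ^+ 2 * (1 - k ^+ 2)); last by ring.
  by rewrite mulf_neq0 ?expf_neq0 ?mulf_neq0 // gt_eqF // subr_gt0.
have [[p01 p02 p03] [[p12 p13 p23] [[q01 q02 q03] [q12 q13 q23]]]] := oppE.
have T01 : t o0 o1 = hh^-1 * (U o0 o1 * row 0).
  by apply: (tE _ _ _ k23) => //; rewrite p01 q01 // ?mxE // /hh; ring.
have T02 : t o0 o2 = hh^-1 * (U o0 o2 * row 1).
  by apply: (tE _ _ _ k13) => //; rewrite p02 q02 // ?mxE // /hh; ring.
have T03 : t o0 o3 = hh^-1 * (U o0 o3 * row 2%:R).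
  by apply: (tE _ _ _ k12) => //; rewrite p03 q03 // ?mxE // /hh; ring.
have T12 : t o1 o2 = hh^-1 * (U o1 o2 * row 3%:R).
  by apply: (tE _ _ _ k03) => //; rewrite p12 q12 // ?mxE // /hh; ring.
have T13 : t o1 o3 = hh^-1 * (U o1 o3 * row 4%:R).
  by apply: (tE _ _ _ k02) => //; rewrite p13 q13 // ?mxE // /hh; ring.
have T23 : t o2 o3 = hh^-1 * (U o2 o3 * row 5%:R).
  by apply: (tE _ _ _ k01) => //; rewrite p23 q23 // ?mxE // /hh; ring.
(* The 2 counts each edge in both orders; [hh] arises because an edge and its complement together
   involve all four scaling factors. *)
have -> : tet_form H u = 2 * (hh^-1 * qform (hess_mx k01 k02 k03 k12 k13 k23) v).
  have -> : tet_form H u = 2 * (t o0 o1 + t o0 o2 + t o0 o3 + t o1 o2 + t o1 o3 + t o2 o3).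
    rewrite /tet_form; under eq_bigr do rewrite big_mkcond sum4E.
    rewrite sum4E /= -/(t o0 o1) -/(t o0 o2) -/(t o0 o3) -/(t o1 o0) -/(t o1 o2) -/(t o1 o3)
     -/(t o2 o0) -/(t o2 o1) -/(t o2 o3) -/(t o3 o0) -/(t o3 o1) -/(t o3 o2).
    rewrite (tC o1 o0) (tC o2 o0) (tC o3 o0) (tC o2 o1) (tC o3 o1) (tC o3 o2); ring.
  rewrite T01 T02 T03 T12 T13 T23 qformE sum6E -!/(row _).
  rewrite ![U _ _]mxE ![v _ _]mxE /=; ring.
rewrite mulr_gt0 // mulr_gt0 ?invr_gt0 // pos_def_hess_mx //.
apply: contra_neq unz => v0; apply/matrixP => i j; rewrite uU [RHS]mxE.
have vj (l : 'I_6) : v 0 l = 0 by rewrite v0 mxE.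
have := vj 0; have := vj 1; have := vj 2%:R; have := vj 3%:R; have := vj 4%:R; have := vj 5%:R.
rewrite !mxE /= => v5' v4' v3' v2' v1' v0'.
rewrite /U v5' v4' v3' v2' v1' v0'.
by move: i j; apply: ord4P; apply: ord4P; rewrite /= mul0r.
Qed.

End TetForm.

(** * Derivatives of the dihedral angles *)

Section Limits.
Variables (R : realType) (T : Type) (F : set_system T).
Context {FF : Filter F}.

Lemma det_cvg n (A : T -> 'M[R]_n) (A0 : 'M[R]_n) :
  (forall i j, A x i j @[x --> F] --> A0 i j) -> \det (A x) @[x --> F] --> \det A0.
Proof.
move=> cA; rewrite /determinant; apply: cvg_sum => s _; apply: cvgM; first exact: cvg_cst.
by apply: cvg_prod => i _.
Qed.

(** [invmx] is defined by cases; near an invertible limit it is given by Cramer's formula. *)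
Lemma invmx_cvg n (A : T -> 'M[R]_n) (A0 : 'M[R]_n) : A0 \in unitmx ->
  (forall i j, A x i j @[x --> F] --> A0 i j) ->
  forall i j, invmx (A x) i j @[x --> F] --> invmx A0 i j.
Proof.
move=> uA cA i j; have cdet := det_cvg cA.
have d0 : \det A0 != 0 by rewrite -unitfE -unitmxE.
have invE (B : 'M[R]_n) : \det B != 0 ->
    invmx B i j = (\det B)^-1 * ((-1) ^+ (j + i) * \det (row' j (col' i B))).
  by move=> B0; rewrite /invmx unitmxE unitfE B0 !mxE.
have near0 : \forall x \near F, \det (A x) != 0 by apply: cvgr_neq0 cdet d0.
have c : (\det (A x))^-1 * ((-1) ^+ (j + i) * \det (row' j (col' i (A x)))) @[x --> F] -->
    (\det A0)^-1 * ((-1) ^+ (j + i) * \det (row' j (col' i A0))).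
  apply: cvgM; first exact: cvgV.
  apply: cvgM; first exact: cvg_cst.
  by apply: det_cvg => k l; under eq_cvg do rewrite !mxE; rewrite !mxE; exact: cA.
rewrite invE //; apply: cvg_trans c.
apply: near_eq_cvg; near=> x; rewrite /= invE //; near: x; exact: near0.
Unshelve. all: by end_near. Qed.

Lemma mulmx3_cvg n (A B C : T -> 'M[R]_n) A0 B0 C0 :
  (forall i j, A x i j @[x --> F] --> (A0 : 'M[R]_n) i j) ->
  (forall i j, B x i j @[x --> F] --> (B0 : 'M[R]_n) i j) ->
  (forall i j, C x i j @[x --> F] --> (C0 : 'M[R]_n) i j) ->
  forall i j, (A x *m B x *m C x) i j @[x --> F] --> (A0 *m B0 *m C0) i j.
Proof.
move=> cA cB cC i j; under eq_cvg do rewrite mxE.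
rewrite mxE; apply: cvg_sum => k _; apply: cvgM => //.
under eq_cvg do rewrite mxE; rewrite mxE; apply: cvg_sum => l _; exact: cvgM.
Qed.

Lemma sqrt_cvg (f : T -> R) (a : R) : f x @[x --> F] --> a ->
  Num.sqrt (f x) @[x --> F] --> Num.sqrt a.
Proof. by move=> fa; apply: (cvg_comp _ _ fa); exact: sqrt_continuous. Qed.

Lemma acos_cvg (f : T -> R) (a : R) : -1 < a < 1 -> f x @[x --> F] --> a ->
  acos (f x) @[x --> F] --> acos a.
Proof. by move=> a1 fa; apply: (cvg_comp _ _ fa); exact: continuous_acos. Qed.

End Limits.

Section Derivatives.
Variable R : realType.
Implicit Types (f g : R -> R) (t : R).

Lemma is_derive1P f t d :
  is_derive t 1 f d <-> h^-1 * (f (h + t) - f t) @[h --> 0^'] --> d.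
Proof.
have E : (fun h : R => h^-1 *: ((f \o shift t) (h *: 1) - f t)) =
    (fun h => h^-1 * (f (h + t) - f t)).
  by apply/funext => h /=; rewrite [h *: 1]mulr1.
split=> [[df dE]|fd].
  by rewrite -E -dE; exact: df.
by split; [apply/cvg_ex; exists d|apply: cvg_lim => //]; rewrite E.
Qed.

Lemma is_derive1_cvg f t d : is_derive t 1 f d -> f (h + t) @[h --> 0^'] --> f t.
Proof.
move/is_derive1P => fd.
have : h * (h^-1 * (f (h + t) - f t)) + f t @[h --> (0 : R)^'] --> 0 * d + f t.
  apply: cvgD; last exact: cvg_cst.
  apply: cvgM => //; have id0 : (0 : R)^' `=>` nbhs (0 : R) by exact: cvg_within.
  by move=> B /id0.
rewrite mul0r add0r; apply: cvg_trans; apply: near_eq_cvg; near=> h.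
rewrite mulrA mulfV ?mul1r ?subrK //; near: h; exact: nbhs_dnbhs_neq.
Unshelve. all: by end_near. Qed.

Lemma is_derive1D f g t df dg : is_derive t 1 f df -> is_derive t 1 g dg ->
  is_derive t 1 (fun s => f s + g s) (df + dg).
Proof. by move=> hf hg; exact: is_deriveD. Qed.

Lemma is_derive1N f t df : is_derive t 1 f df -> is_derive t 1 (fun s => - f s) (- df).
Proof. by move=> hf; exact: is_deriveN. Qed.

Lemma is_derive1_const (c t : R) : is_derive t 1 (fun=> c) 0.
Proof. exact: is_derive_cst. Qed.

Lemma is_derive1M f g t df dg : is_derive t 1 f df -> is_derive t 1 g dg ->
  is_derive t 1 (fun s => f s * g s) (df * g t + f t * dg).
Proof.
move=> hf hg; apply: is_derive_eq (is_deriveM hf hg) _.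
by rewrite addrC [df * _]mulrC.
Qed.

Lemma is_derive1_div f g t df dg : g t != 0 ->
  is_derive t 1 f df -> is_derive t 1 g dg ->
  is_derive t 1 (fun s => f s / g s) ((df * g t - f t * dg) / g t ^+ 2).
Proof.
move=> g0 hf hg.
apply: is_derive_eq (is_derive1M hf (is_deriveV g0 hg)) _.
by rewrite /GRing.scale /=; field.
Qed.

Lemma is_derive1_sqrt_comp f t df : 0 < f t -> is_derive t 1 f df ->
  is_derive t 1 (fun s => Num.sqrt (f s)) (df / (2 * Num.sqrt (f t))).
Proof.
move=> f0 hf; apply: is_derive_eq (is_derive1_comp (is_derive1_sqrt f0) hf) _.
by rewrite mulrC.
Qed.

Lemma is_derive1_acos_comp f t df : -1 < f t < 1 -> is_derive t 1 f df ->
  is_derive t 1 (fun s => acos (f s)) (- df / Num.sqrt (1 - f t ^+ 2)).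
Proof.
move=> f1 hf; apply: is_derive_eq (is_derive1_comp (is_derive1_acos f1) hf) _.
by rewrite mulNr mulrC mulNr.
Qed.

Lemma is_derive1_sum (I : Type) (r : seq I) (P : pred I) (f : I -> R -> R)
    (d : I -> R) t : (forall i, P i -> is_derive t 1 (f i) (d i)) ->
  is_derive t 1 (fun s => \sum_(i <- r | P i) f i s) (\sum_(i <- r | P i) d i).
Proof.
move=> hf; elim: r => [|i r IH].
  rewrite big_nil (_ : (fun _ => _) = cst 0); first exact: is_derive_cst.
  by apply/funext => s; rewrite big_nil.
rewrite big_cons (_ : (fun _ => _) = if P i then
    (fun s => f i s + \sum_(j <- r | P j) f j s) else (fun s => \sum_(j <- r | P j) f j s)).
  by case: ifP => // Pi; apply: is_derive1D => //; exact: hf.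
by apply/funext => s; rewrite big_cons; case: ifP.
Qed.

(** The difference of two inverses is [- invmx (A s) *m (A s - A t) *m invmx (A t)]; divide by
    [s - t] and pass to the limit. *)
Lemma invmx_derive n (A : R -> 'M[R]_n) (dA : 'M[R]_n) t : A t \in unitmx ->
  (forall i j, is_derive t 1 (fun s => A s i j) (dA i j)) ->
  forall i j, is_derive t 1 (fun s => invmx (A s) i j)
    (- (invmx (A t) *m dA *m invmx (A t)) i j).
Proof.
move=> uA hA i j; apply/is_derive1P.
have cA k l : A (h + t) k l @[h --> (0 : R)^'] --> A t k l.
  exact: (is_derive1_cvg (hA k l)).
have near_unit : \forall h \near (0 : R)^', A (h + t) \in unitmx.
  near=> h; rewrite unitmxE unitfE; near: h; apply: cvgr_neq0 (det_cvg cA) _.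
  by rewrite -unitfE -unitmxE.
have c : - (invmx (A (h + t)) *m (h^-1 *: (A (h + t) - A t)) *m invmx (A t)) i j
    @[h --> (0 : R)^'] --> - (invmx (A t) *m dA *m invmx (A t)) i j.
  apply: cvgN; apply: mulmx3_cvg.
  - by apply: invmx_cvg.
  - move=> k l; have /is_derive1P hkl := hA k l; under eq_cvg do rewrite !mxE.
    exact: hkl.
  - by move=> k l; exact: cvg_cst.
apply: cvg_trans c.
apply: near_eq_cvg; near=> h.
have uAh : A (h + t) \in unitmx by near: h; exact: near_unit.
rewrite /= -scalemxAr -scalemxAl mulmxBr mulmxBl mulVmx // mul1mx -mulmxA mulmxV // mulmx1.
rewrite !mxE; ring.
Unshelve. all: by end_near. Qed.

End Derivatives.

Section GramAngle.
Variable R : realType.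
Implicit Types X : 'I_4 -> 'I_4 -> R.

(* [dihedral L] is convertible to [gram_angle (fun a b => cosh (L a b))]. *)
Definition gram_angle X (a b : 'I_4) : R :=
  let H := invmx (gram X) in let c := opp1 a b in let d := opp2 a b in
  acos (- H c d / Num.sqrt (H c c * H d d)).

Lemma gram_angleC X a b : (forall i j, X i j = X j i) -> gram_angle X a b = gram_angle X b a.
Proof. by move=> XC; rewrite /gram_angle (oppC a b).1 (oppC a b).2. Qed.

Lemma gram_minor_gt0 X a b : gram_adm X -> a != b ->
  0 < minor2 (invmx (gram X)) (opp1 a b) (opp2 a b).
Proof.
move=> adm ab; rewrite inv_gram_minor //; case: adm => _ X1 det.
by rewrite divr_gt0 ?oppr_gt0 // subr_gt0 expr_gt1 // ?X1 // ltW // (lt_trans ltr01) // X1.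
Qed.

Lemma gram_cos_itv X a b : gram_adm X -> a != b ->
  forall H c d, H = invmx (gram X) -> c = opp1 a b -> d = opp2 a b ->
  -1 < - H c d / Num.sqrt (H c c * H d d) < 1.
Proof.
move=> adm ab H c d HE cE dE; have m0 := gram_minor_gt0 adm ab.
have pq : 0 < H c c * H d d by rewrite HE mulr_gt0 // inv_gram_diag.
rewrite -HE -cE -dE in m0.
rewrite -ltr_norml normrM normrN normfV [X in _ / X]ger0_norm ?sqrtr_ge0 //.
rewrite ltr_pdivrMr ?sqrtr_gt0 // mul1r -[X in X < _]sqrtr_sqr.
by rewrite ltr_sqrt // -subr_gt0.
Qed.

Lemma gram_cvg (T : Type) (F : set_system T) {FF : Filter F}
    (X : T -> 'I_4 -> 'I_4 -> R) X0 :
  (forall a b, a != b -> X x a b @[x --> F] --> X0 a b) ->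
  forall i j, gram (X x) i j @[x --> F] --> gram X0 i j.
Proof.
move=> cX i j; under eq_cvg do rewrite mxE.
rewrite mxE; case: ifPn => ij; first exact: cvg_cst.
by apply: cvgN; exact: cX.
Qed.

Lemma gram_unit X : gram_adm X -> gram X \in unitmx.
Proof. by case=> _ _ det; rewrite unitmxE unitfE lt_eqF. Qed.

Lemma gram_angle_cvg (T : Type) (F : set_system T) {FF : Filter F}
    (X : T -> 'I_4 -> 'I_4 -> R) X0 a b : gram_adm X0 -> a != b ->
  (forall a b, a != b -> X x a b @[x --> F] --> X0 a b) ->
  gram_angle (X x) a b @[x --> F] --> gram_angle X0 a b.
Proof.
move=> adm ab cX; 
have cH i j : invmx (gram (X x)) i j @[x --> F] --> invmx (gram X0) i j.
  by move: i j; apply: invmx_cvg; [exact: gram_unit|exact: gram_cvg].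
apply: acos_cvg; first exact: (gram_cos_itv adm ab (erefl _) (erefl _) (erefl _)).
apply: cvgM; first by apply: cvgN; exact: cH.
apply: cvgV; first by rewrite gt_eqF // sqrtr_gt0 mulr_gt0 // inv_gram_diag.
by apply: sqrt_cvg; apply: cvgM; exact: cH.
Qed.

Lemma tet_form_cvg (T : Type) (F : set_system T) {FF : Filter F}
    (X : T -> 'I_4 -> 'I_4 -> R) X0 (u : T -> 'M[R]_4) (u0 : 'M[R]_4) : gram_adm X0 ->
  (forall a b, a != b -> X x a b @[x --> F] --> X0 a b) ->
  (forall a b, u x a b @[x --> F] --> u0 a b) ->
  tet_form (invmx (gram (X x))) (u x) @[x --> F] --> tet_form (invmx (gram X0)) u0.
Proof.
move=> adm cX cu; 
have cH i j : invmx (gram (X x)) i j @[x --> F] --> invmx (gram X0) i j.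
  by move: i j; apply: invmx_cvg; [exact: gram_unit|exact: gram_cvg].
apply: cvg_sum => a _; apply: cvg_sum => b ba; apply: cvgM; first exact: cu.
have cB i j : (invmx (gram (X x)) *m u x *m invmx (gram (X x))) i j @[x --> F] -->
    (invmx (gram X0) *m u0 *m invmx (gram X0)) i j by exact: mulmx3_cvg.
have half c : invmx (gram X0) c c != 0 by rewrite gt_eqF // inv_gram_diag.
apply: cvgM.
  apply: cvgB; first exact: cB.
  apply: cvgM; first by apply: cvgM; [exact: cH|exact: cvg_cst].
  by apply: cvgD; (apply: cvgM; first exact: cB); apply: cvgV; do [exact: half|exact: cH].
apply: cvgV; first by rewrite gt_eqF // gram_minor_gt0 // eq_sym.
apply: cvgB; first by apply: cvgM; exact: cH.
by apply: cvg_exprn; exact: cH.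
Qed.

(** The off-diagonal entries of the Gram matrix are [- X], so its velocity is [- u] and that of its
    inverse [H *m u *m H]. The normalising factor of the cosine cancels against the one in
    [1 - cos ^+ 2], leaving the root of the 2x2 minor. *)
Lemma gram_angle_derive (X : R -> 'I_4 -> 'I_4 -> R) (u : 'M[R]_4) t a b :
  gram_adm (X t) -> a != b -> (forall i, u i i = 0) ->
  (forall i j, i != j -> is_derive t 1 (fun s => X s i j) (u i j)) ->
  let H := invmx (gram (X t)) in let c := opp1 a b in let d := opp2 a b in
  is_derive t 1 (fun s => gram_angle (X s) a b)
    (offdiag_rate H (H *m u *m H) c d / Num.sqrt (minor2 H c d)).
Proof.
move=> adm ab u0 dX H c d.
have dG i j : is_derive t 1 (fun s => gram (X s) i j) ((- u) i j).
  rewrite (_ : (fun s => _) = (fun s => if i == j then 1 else - X s i j)); last first.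
    by apply/funext => s; rewrite mxE.
  rewrite mxE; have [<-|ij] := eqVneq i j; first by rewrite u0 oppr0; exact: is_derive1_const.
  by apply: is_derive1N; exact: dX.
have dH i j : is_derive t 1 (fun s => invmx (gram (X s)) i j) ((H *m u *m H) i j).
  apply: is_derive_eq (invmx_derive (gram_unit adm) dG i j) _.
  by rewrite mulmxN mulNmx mxE opprK.
have Hc : 0 < H c c by exact: inv_gram_diag.
have Hd : 0 < H d d by exact: inv_gram_diag.
have pq : 0 < H c c * H d d by rewrite mulr_gt0.
have m0 : 0 < minor2 H c d by exact: gram_minor_gt0.
have S0 : 0 < Num.sqrt (H c c * H d d) by rewrite sqrtr_gt0.
pose Hs i j s := invmx (gram (X s)) i j.
have dS := @is_derive1_sqrt_comp _ (fun s => Hs c c s * Hs d d s) t _ pq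
  (is_derive1M (dH c c) (dH d d)).
have dchi := @is_derive1_div _ (fun s => - Hs c d s)
  (fun s => Num.sqrt (Hs c c s * Hs d d s)) t _ _ (lt0r_neq0 S0) (is_derive1N (dH c d)) dS.
have citv : -1 < - Hs c d t / Num.sqrt (Hs c c t * Hs d d t) < 1.
  exact: (gram_cos_itv adm ab).
apply: is_derive_eq (@is_derive1_acos_comp _ (fun s => - Hs c d s /
  Num.sqrt (Hs c c s * Hs d d s)) t _ citv dchi) _.
rewrite /Hs.
rewrite -/H -/c -/d.
have -> : 1 - (- H c d / Num.sqrt (H c c * H d d)) ^+ 2 = minor2 H c d / (H c c * H d d).
  rewrite expr_div_n sqr_sqrtr ?ltW // sqrrN /minor2; field.
  by rewrite !gt_eqF.
rewrite [Num.sqrt (minor2 _ _ _ / _)]sqrtrM ?ltW // sqrtrV ?ltW //.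
have := sqr_sqrtr (ltW pq); set S := Num.sqrt (H c c * H d d) in S0 *.
have M0 : 0 < Num.sqrt (minor2 H c d) by rewrite sqrtr_gt0.
set M := Num.sqrt (minor2 H c d) in M0 *.
move=> S2; rewrite /offdiag_rate.
set w := H c d; set w' := (H *m u *m H) c d.
set p' := (H *m u *m H) c c; set q' := (H *m u *m H) d d.
have pE : H c c = S ^+ 2 / H d d by rewrite S2 mulfK ?gt_eqF.
rewrite pE; field.
by rewrite !gt_eqF.
Qed.

End GramAngle.

(** * Sphere packings *)

Section Hyperbolic.
Variable R : realType.
Implicit Types x : R.

Lemma cosh_gt0 x : 0 < cosh x.
Proof. by rewrite /cosh divr_gt0 // addr_gt0 // expR_gt0. Qed.

Lemma sinh_gt0 x : 0 < x -> 0 < sinh x.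
Proof. by move=> x0; rewrite /sinh divr_gt0 // subr_gt0 ltr_expR; lra. Qed.

Lemma expR_acosh x : 1 <= x ->
  expR (acosh x) = x + Num.sqrt (x ^+ 2 - 1) /\ expR (- acosh x) = x - Num.sqrt (x ^+ 2 - 1).
Proof.
move=> x1; have s0 : 0 <= x ^+ 2 - 1 by rewrite subr_ge0 expr_ge1 // (le_trans ler01).
have y0 : 0 < x + Num.sqrt (x ^+ 2 - 1).
  by rewrite ltr_pwDl ?sqrtr_ge0 // (lt_le_trans ltr01).
have yE : expR (acosh x) = x + Num.sqrt (x ^+ 2 - 1) by rewrite lnK.
split=> //; rewrite expRN yE; apply: (mulfI (lt0r_neq0 y0)); rewrite mulfV ?gt_eqF //.
by rewrite mulrC -subr_sqr sqr_sqrtr //; ring.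
Qed.

Lemma acoshK x : 1 <= x -> cosh (acosh x) = x.
Proof. by move=> /expR_acosh[E1 E2]; rewrite /cosh E1 E2; field. Qed.

Lemma sinh_acosh x : 1 <= x -> sinh (acosh x) = Num.sqrt (x ^+ 2 - 1).
Proof. by move=> /expR_acosh[E1 E2]; rewrite /sinh E1 E2; field. Qed.

Lemma sinh_cvg (T : Type) (F : set_system T) {FF : Filter F} (f : T -> R) (a : R) :
  f x @[x --> F] --> a -> sinh (f x) @[x --> F] --> sinh a.
Proof.
move=> fa; apply: cvgM; last exact: cvg_cst.
apply: cvgB; first by apply: (cvg_comp _ _ fa); exact: continuous_expR.
by apply: (cvg_comp _ _ (cvgN fa)); exact: continuous_expR.
Qed.

Lemma cosh_cvg (T : Type) (F : set_system T) {FF : Filter F} (f : T -> R) (a : R) :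
  f x @[x --> F] --> a -> cosh (f x) @[x --> F] --> cosh a.
Proof.
move=> fa; apply: cvgM; last exact: cvg_cst.
apply: cvgD; first by apply: (cvg_comp _ _ fa); exact: continuous_expR.
by apply: (cvg_comp _ _ (cvgN fa)); exact: continuous_expR.
Qed.

Lemma is_derive1_expR_comp (f : R -> R) (t df : R) : is_derive t 1 f df ->
  is_derive t 1 (fun s => expR (f s)) (expR (f t) * df).
Proof. by move=> hf; exact: (is_derive1_comp (is_derive_expR (f t)) hf). Qed.

Lemma is_derive1_sinh_comp (f : R -> R) (t df : R) : is_derive t 1 f df ->
  is_derive t 1 (fun s => sinh (f s)) (df * cosh (f t)).
Proof.
move=> hf; apply: is_derive_eq (is_derive1M (is_derive1D (is_derive1_expR_comp hf)
  (is_derive1N (is_derive1_expR_comp (is_derive1N hf)))) (is_derive1_const 2^-1 t)) _.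
by rewrite /cosh; ring.
Qed.

Lemma is_derive1_cosh_comp (f : R -> R) (t df : R) : is_derive t 1 f df ->
  is_derive t 1 (fun s => cosh (f s)) (df * sinh (f t)).
Proof.
move=> hf; apply: is_derive_eq (is_derive1M (is_derive1D (is_derive1_expR_comp hf)
  (is_derive1_expR_comp (is_derive1N hf))) (is_derive1_const 2^-1 t)) _.
by rewrite /sinh; ring.
Qed.

Lemma det_lorentzJ : \det (lorentzJ R) = -1.
Proof.
have -> : lorentzJ R = diag_mx (\row_i (if i == 0 then -1 else 1)).
  apply/matrixP => i j; rewrite !mxE; case: eqVneq => [->|]; rewrite ?mulr1n ?mulr0n //.
rewrite det_diag; under eq_bigr do rewrite mxE.
by rewrite !big_ord_recl big_ord0 /= !mulr1.
Qed.

End Hyperbolic.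

Section Packing.
Variables (R : realType) (N : nat) (T : seq {ffun 'I_4 -> 'I_N}) (Phi : 'I_N -> 'I_N -> R).
Hypothesis T_inj : forall t, t \in T -> injective t.
Hypothesis PhiC : forall i j, Phi i j = Phi j i.
Implicit Types (r v : 'I_N -> R) (t : {ffun 'I_4 -> 'I_N}).

Local Notation ch := (cosh_len Phi).

Definition ch_partial r i j : R :=
  cosh (r i) * sinh (r j) + cos (Phi i j) * sinh (r i) * cosh (r j).

Definition dch r v i j : R := ch_partial r i j * v i + ch_partial r j i * v j.

(** [ch] is its own second derivative in each of the two radii, whence the first term. *)
Definition d2ch r v i j : R := ch r i j * (v i ^+ 2 + v j ^+ 2) +
  2 * (cosh (r i) * cosh (r j) + cos (Phi i j) * sinh (r i) * sinh (r j)) * v i * v j.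

Definition sh r i j : R := Num.sqrt (ch r i j ^+ 2 - 1).

Definition dlen r v i j : R := dch r v i j / sh r i j.

Definition d2len r v i j : R :=
  (d2ch r v i j * sh r i j ^+ 2 - ch r i j * dch r v i j ^+ 2) / sh r i j ^+ 3.

Definition tet_ch r t (a b : 'I_4) : R := ch r (t a) (t b).

Definition tet_dch r v t : 'M[R]_4 :=
  \matrix_(a, b) (if a == b then 0 else dch r v (t a) (t b)).

(** A form of the metric condition made of strict inequalities between continuous functions, hence
    open. *)
Definition near_metric r : Prop := (forall i j, is_edge T i j -> 1 < ch r i j) /\
  (forall t, t \in T -> gram_adm (tet_ch r t)).

(** The filter [t \in T] keeps membership at hand under the sum. *)
Definition edge_curv r i j : R :=
  2 * pi - \sum_(t <- T | t \in T) \sum_a \sum_(b | (t a == i) && (t b == j))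
    gram_angle (tet_ch r t) a b.

(** Twice the Hessian described above, because every edge is met in both orders. *)
Definition hess_form r v : R :=
  \sum_i \sum_(j | is_edge T i j) edge_curv r i j * d2len r v i j
  - \sum_(t <- T | t \in T)
      tet_form (invmx (gram (tet_ch r t))) (tet_dch r v t) /
      Num.sqrt (- \det (gram (tet_ch r t))).

Lemma chC r i j : ch r i j = ch r j i.
Proof. by rewrite /cosh_len PhiC; ring. Qed.

Lemma dchC r v i j : dch r v i j = dch r v j i.
Proof. by rewrite /dch addrC. Qed.

Lemma is_edgeC i j : is_edge T i j = is_edge T j i.
Proof. by rewrite /is_edge eq_sym; congr (_ && _); apply: eq_has => t; rewrite andbC. Qed.

Lemma edge_tet t a b : t \in T -> a != b -> is_edge T (t a) (t b).
Proof.
move=> tT ab; rewrite /is_edge; apply/andP; split.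
  by apply: contra ab => /eqP/(T_inj tT)/eqP.
by apply/hasP; exists t => //; rewrite !codom_f.
Qed.

Lemma edge_curvC r i j : edge_curv r i j = edge_curv r j i.
Proof.
rewrite /edge_curv; congr (_ - _); apply: eq_bigr => t tT.
rewrite (exchange_big_dep predT) //=; apply: eq_bigr => b _.
apply: eq_big => [a|a _]; first by rewrite andbC.
by apply: gram_angleC => k l; exact: chC.
Qed.

(** A Gram matrix [V *m J *m V^T] has determinant [- (\det V) ^+ 2], which is negative for
    invertible [V]. *)
Lemma sp_metric_near r : sp_metric T Phi r -> near_metric r.
Proof.
case=> _ [e1 hT]; split=> // t tT.
have X1 a b : a != b -> 1 < tet_ch r t a b by move=> ab; exact: e1 (edge_tet tT ab).
split=> // [a b|]; first exact: chC.
have -> : gram (tet_ch r t) = tet_gram (tet_len Phi r t).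
  apply/matrixP => a b; rewrite !mxE; case: eqVneq => // ab.
  by rewrite acoshK // ltW // X1.
have [_ [V [uV <-]]] := hT _ tT.
rewrite !det_mulmx det_tr det_lorentzJ mulrN1 mulNr oppr_lt0 -expr2.
by rewrite lt_def sqr_ge0 andbT sqrf_eq0 -unitfE -unitmxE.
Qed.

Lemma Kedge_near r i j : near_metric r -> Kedge T Phi r i j = edge_curv r i j.
Proof.
move=> [e1 hT]; rewrite /Kedge /edge_curv; congr (_ - _); rewrite big_seq.
apply: eq_bigr => t tT; apply: eq_bigr => a _; apply: eq_bigr => b _.
rewrite /dihedral /gram_angle.
have -> // : tet_gram (tet_len Phi r t) = gram (tet_ch r t).
apply/matrixP => k l; rewrite !mxE; case: eqVneq => // kl.
by rewrite acoshK // ltW // e1 // edge_tet.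
Qed.

Lemma sh_gt0 r i j : 1 < ch r i j -> 0 < sh r i j.
Proof. by move=> c1; rewrite sqrtr_gt0 subr_gt0 expr_gt1 // ltW // (lt_trans ltr01). Qed.

Lemma sh2 r i j : 1 < ch r i j -> sh r i j ^+ 2 = ch r i j ^+ 2 - 1.
Proof. by move=> /sh_gt0; rewrite sqrtr_gt0 => /ltW/sqr_sqrtr. Qed.

(** Each [dlen] splits into its two partial derivatives, and the symmetry of [edge_curv] makes the
    two resulting sums equal. *)
Lemma sum_Kvert r v : near_metric r -> \sum_i v i * Kvert T Phi r i =
  2^-1 * \sum_i \sum_(j | is_edge T i j) edge_curv r i j * dlen r v i j.
Proof.
move=> nr; have [e1 _] := nr.
pose f i j := edge_curv r i j * (ch_partial r i j / sh r i j * v i).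
have -> : \sum_i v i * Kvert T Phi r i = \sum_i \sum_(j | is_edge T i j) f i j.
  apply: eq_bigr => i _; rewrite /Kvert mulr_sumr; apply: eq_bigr => j ij.
  by rewrite Kedge_near // /cosh_theta /len sinh_acosh ?ltW ?e1 // /f -/(sh r i j)
    -/(ch_partial r i j); ring.
have fC : \sum_i \sum_(j | is_edge T i j) f i j = \sum_i \sum_(j | is_edge T i j) f j i.
  rewrite (exchange_big_dep predT) //=; apply: eq_bigr => i _.
  by apply: eq_bigl => j; rewrite is_edgeC.
have -> : \sum_i \sum_(j | is_edge T i j) edge_curv r i j * dlen r v i j =
    \sum_i \sum_(j | is_edge T i j) f i j + \sum_i \sum_(j | is_edge T i j) f j i.
  rewrite -big_split /=; apply: eq_bigr => i _; rewrite -big_split /=; apply: eq_bigr => j _.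
  by rewrite /f (edge_curvC r j i) /sh (chC r j i) -/(sh r i j) /dlen /dch; ring.
by rewrite -fC; field.
Qed.

Lemma d2len_numerator r v i j :
  d2ch r v i j * (ch r i j ^+ 2 - 1) - ch r i j * dch r v i j ^+ 2 =
  - sin (Phi i j) ^+ 2 *
    (ch r i j * ((cosh (r j) * v i) ^+ 2 + (cosh (r i) * v j) ^+ 2)
     + 2 * (cosh (r j) * v i) * (cosh (r i) * v j)).
Proof.
rewrite sin2cos2 /d2ch /dch /ch_partial /cosh_len (PhiC j i).
rewrite /cosh /sinh !expRN.
(* In the exponentials of the two radii the identity is one of rational functions. *)
have p0 : expR (r i) != 0 by rewrite gt_eqF // expR_gt0.
have q0 : expR (r j) != 0 by rewrite gt_eqF // expR_gt0.
move: p0 q0; set p := expR (r i); set q := expR (r j); set c := cos _ => p0 q0.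
by field; rewrite p0 q0.
Qed.

Lemma ch_partial_gt0 r i j : (forall k, 0 < r k) -> 0 <= cos (Phi i j) ->
  0 < ch_partial r i j.
Proof.
move=> r0 c0; apply: ltr_wpDr; last by rewrite mulr_gt0 ?cosh_gt0 ?sinh_gt0.
apply: mulr_ge0; last exact/ltW/cosh_gt0.
by apply: mulr_ge0 => //; exact/ltW/sinh_gt0.
Qed.

Lemma tet_dch_sym r v t : (tet_dch r v t)^T = tet_dch r v t.
Proof.
apply/matrixP => a b; rewrite !mxE eq_sym; case: eqVneq => // _; exact: dchC.
Qed.

(* If the three edges of a triangle are stationary, the radii at its vertices
   change with pairwise opposite signs, hence not at all. *)
Lemma tet_dch_eq0 r v t a : t \in T -> (forall k, 0 < r k) ->
  (forall i j, is_edge T i j -> 0 <= cos (Phi i j)) ->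
  tet_dch r v t = 0 -> v (t a) = 0.
Proof.
move=> tT r0 c0 d0.
have [b [c [ab ac bc]]] : exists b c, [/\ a != b, a != c & b != c].
  by move: a; apply: ord4P; [exists o1, o2|exists o0, o2|exists o0, o1|exists o0, o1].
have dE k l : k != l -> dch r v (t k) (t l) = 0.
  move=> kl; have := congr1 (fun A : 'M[R]_4 => A k l) d0.
  by rewrite !mxE (negbTE kl).
have p k l : k != l -> 0 < ch_partial r (t k) (t l).
  by move=> kl; apply: ch_partial_gt0 => //; apply: c0; exact: edge_tet.
have opp_sign (x y p1 p2 : R) : 0 < p1 -> 0 < p2 -> p1 * x + p2 * y = 0 ->
    (0 < x -> y < 0) /\ (x < 0 -> 0 < y).
  by move=> *; split=> ?; nra.
have [ab1 ab2] := opp_sign _ _ _ _ (p a b ab) (p b a ltac:(by rewrite eq_sym)) (dE a b ab).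
have [ac1 ac2] := opp_sign _ _ _ _ (p a c ac) (p c a ltac:(by rewrite eq_sym)) (dE a c ac).
have [bc1 bc2] := opp_sign _ _ _ _ (p b c bc) (p c b ltac:(by rewrite eq_sym)) (dE b c bc).
have [va|va|//] := ltgtP (v (t a)) 0.
- by have := ac2 va; rewrite ltNge (ltW (bc1 (ab2 va))).
- by have := ac1 va; rewrite ltNge (ltW (bc2 (ab1 va))).
Qed.

Lemma hess_form_lt0 r v : sp_metric T Phi r ->
  (forall i, has (fun t : {ffun 'I_4 -> 'I_N} => i \in codom t) T) ->
  (forall i j, is_edge T i j -> 0 <= cos (Phi i j)) ->
  (forall i j, is_edge T i j -> 0 <= Kedge T Phi r i j * sin (Phi i j) ^+ 2) ->
  (exists i, v i != 0) -> hess_form r v < 0.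
Proof.
move=> spr cover c0 K0 [i vi]; have nr := sp_metric_near spr.
have [e1 adm] := nr; have [r0 _] := spr.
have curv_le0 : \sum_i \sum_(j | is_edge T i j) edge_curv r i j * d2len r v i j <= 0.
  apply: sumr_le0 => k _; apply: sumr_le0 => l kl.
  have c1 := e1 _ _ kl.
  rewrite /d2len sh2 // d2len_numerator.
  (* [Q] equals [(ch - 1) * (x ^+ 2 + y ^+ 2) + (x + y) ^+ 2]. *)
  set Q := (_ + _ : R); have Q0 : 0 <= Q.
    rewrite /Q; set x := cosh (r l) * v k; set y := cosh (r k) * v l.
    have : 0 <= (ch r k l - 1) * (x ^+ 2 + y ^+ 2).
      by apply: mulr_ge0; rewrite ?subr_ge0 ?(ltW c1) // addr_ge0 ?sqr_ge0.
    by have := sqr_ge0 (x + y); nra.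
  have := K0 _ _ kl; rewrite Kedge_near // => Ks.
  have -> : edge_curv r k l * (- sin (Phi k l) ^+ 2 * Q / sh r k l ^+ 3) =
    - (edge_curv r k l * sin (Phi k l) ^+ 2 * (Q / sh r k l ^+ 3)) by ring.
  by rewrite oppr_le0 mulr_ge0 // divr_ge0 // exprn_ge0 // ltW // sh_gt0.
pose F t := tet_form (invmx (gram (tet_ch r t))) (tet_dch r v t) /
      Num.sqrt (- \det (gram (tet_ch r t))).
have S0 t : t \in T -> 0 < Num.sqrt (- \det (gram (tet_ch r t))).
  by move=> /adm[_ _ det]; rewrite sqrtr_gt0 oppr_gt0.
have u0 t a : tet_dch r v t a a = 0 by rewrite mxE eqxx.
have Fgt0 t : t \in T -> tet_dch r v t != 0 -> 0 < F t.
  move=> tT u; rewrite divr_gt0 ?S0 // tet_form_gt0 //; first exact: adm.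
  exact: tet_dch_sym.
have F_ge0 t : t \in T -> 0 <= F t.
  move=> tT; have [u|u] := eqVneq (tet_dch r v t) 0; last exact/ltW/Fgt0.
  rewrite /F u (_ : tet_form _ 0 = 0) ?mul0r // /tet_form.
  by apply: big1 => a _; apply: big1 => b _; rewrite mxE mul0r.
(* A tetrahedron containing a vertex whose radius moves contributes strictly; all the others
   contribute with the same weak sign. *)
have [t tT /codomP[a ia]] := hasP (cover i).
have u : tet_dch r v t != 0.
  apply: contra_neq vi => /(tet_dch_eq0 a tT r0 c0); by rewrite -ia.
rewrite /hess_form subr_lt0; apply: (le_lt_trans curv_le0).
rewrite -big_seq (big_rem t) //= ltr_pwDl ?Fgt0 // big_seq sumr_ge0 // => t' t'T.
by apply: F_ge0; exact: mem_rem t'T.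
Qed.

(** * Joint continuity in the radii and the direction *)

Section Continuity.
Variables (S : Type) (F : set_system S).
Context {FF : Filter F}.
Variables (r v : S -> 'I_N -> R) (r0 v0 : 'I_N -> R).
Hypothesis r_cvg : forall i, r x i @[x --> F] --> r0 i.
Hypothesis v_cvg : forall i, v x i @[x --> F] --> v0 i.

Lemma ch_cvg i j : ch (r x) i j @[x --> F] --> ch r0 i j.
Proof.
apply: cvgD; first by apply: cvgM; apply: sinh_cvg.
by apply: cvgM; [apply: cvgM; [exact: cvg_cst|]|]; apply: cosh_cvg.
Qed.

Lemma ch_partial_cvg i j : ch_partial (r x) i j @[x --> F] --> ch_partial r0 i j.
Proof.
apply: cvgD; first by apply: cvgM; [exact: cosh_cvg|exact: sinh_cvg].
by apply: cvgM; [apply: cvgM; [exact: cvg_cst|exact: sinh_cvg]|exact: cosh_cvg].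
Qed.

Lemma dch_cvg i j : dch (r x) (v x) i j @[x --> F] --> dch r0 v0 i j.
Proof. by apply: cvgD; apply: cvgM => //; exact: ch_partial_cvg. Qed.

Lemma sh_cvg i j : sh (r x) i j @[x --> F] --> sh r0 i j.
Proof.
apply: sqrt_cvg; apply: cvgB; last exact: cvg_cst.
by apply: cvg_exprn; exact: ch_cvg.
Qed.

Lemma d2ch_cvg i j : d2ch (r x) (v x) i j @[x --> F] --> d2ch r0 v0 i j.
Proof.
apply: cvgD.
  by apply: cvgM; [exact: ch_cvg|apply: cvgD; exact: cvg_exprn].
apply: cvgM => //; apply: cvgM => //; apply: cvgM; first exact: cvg_cst.
apply: cvgD; first by apply: cvgM; exact: cosh_cvg.
by apply: cvgM; [apply: cvgM; [exact: cvg_cst|]|]; exact: sinh_cvg.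
Qed.

Lemma d2len_cvg i j : 1 < ch r0 i j -> d2len (r x) (v x) i j @[x --> F] --> d2len r0 v0 i j.
Proof.
move=> c1; apply: cvgM.
  apply: cvgB; apply: cvgM.
  - exact: d2ch_cvg.
  - by apply: cvg_exprn; exact: sh_cvg.
  - exact: ch_cvg.
  - by apply: cvg_exprn; exact: dch_cvg.
apply: cvgV; first by rewrite expf_neq0 // gt_eqF // sh_gt0.
by apply: cvg_exprn; exact: sh_cvg.
Qed.

Lemma tet_ch_cvg t a b : tet_ch (r x) t a b @[x --> F] --> tet_ch r0 t a b.
Proof. exact: ch_cvg. Qed.

Lemma tet_dch_cvg t a b : tet_dch (r x) (v x) t a b @[x --> F] --> tet_dch r0 v0 t a b.
Proof.
under eq_cvg do rewrite mxE; rewrite mxE; case: ifP => _; first exact: cvg_cst.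
exact: dch_cvg.
Qed.

Lemma edge_curv_cvg i j : near_metric r0 -> i != j ->
  edge_curv (r x) i j @[x --> F] --> edge_curv r0 i j.
Proof.
move=> [_ adm] ij; apply: cvgB; first exact: cvg_cst.
apply: cvg_sum => t tT; apply: cvg_sum => a _; apply: cvg_sum => b /andP[/eqP ai /eqP bj].
apply: gram_angle_cvg; [exact: adm| |by move=> *; exact: tet_ch_cvg].
by apply: contra ij => /eqP ab; rewrite -ai -bj ab.
Qed.

Lemma hess_form_cvg : near_metric r0 ->
  hess_form (r x) (v x) @[x --> F] --> hess_form r0 v0.
Proof.
move=> nr; have [e1 adm] := nr; apply: cvgB.
  apply: cvg_sum => i _; apply: cvg_sum => j ij; apply: cvgM.
    by apply: edge_curv_cvg => //; case/andP: ij.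
  exact/d2len_cvg/e1.
apply: cvg_sum => t tT; apply: cvgM.
  apply: tet_form_cvg; [exact: adm|by move=> *; exact: tet_ch_cvg|exact: tet_dch_cvg].
have [_ _ det] := adm _ tT.
apply: cvgV; first by rewrite gt_eqF // sqrtr_gt0 oppr_gt0.
apply: sqrt_cvg; apply: cvgN; apply: det_cvg; apply: gram_cvg => *; exact: tet_ch_cvg.
Qed.

Lemma near_metric_near : near_metric r0 -> \forall x \near F, near_metric (r x).
Proof.
move=> [e1 adm].
have h1 : \forall x \near F, forall i j, is_edge T i j -> 1 < ch (r x) i j.
  apply: filter_forall => i; apply: filter_forall => j.
  have [ij|nij] := boolP (is_edge T i j); last by near=> x.
  have h : \forall x \near F, 1 < ch (r x) i j.
    by apply: (cvgr_gt _ (@ch_cvg i j)); exact: e1.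
  exact: filterS h.
have h2 : \forall x \near F, forall t, t \in T -> \det (gram (tet_ch (r x) t)) < 0.
  apply: filter_forall => t; have [tT|ntT] := boolP (t \in T); last by near=> x.
  have [_ _ det] := adm _ tT.
  have dc : \det (gram (tet_ch (r x) t)) @[x --> F] --> \det (gram (tet_ch r0 t)).
    by apply: det_cvg; apply: gram_cvg => *; exact: tet_ch_cvg.
  have h : \forall x \near F, \det (gram (tet_ch (r x) t)) < 0.
    exact: (cvgr_lt _ dc).
  exact: filterS h.
near=> x; have g1 : forall i j, is_edge T i j -> 1 < ch (r x) i j by near: x.
have g2 : forall t, t \in T -> \det (gram (tet_ch (r x) t)) < 0 by near: x.
split=> // t tT; split; [by move=> *; exact: chC| |exact: g2].
by move=> a b ab; apply: g1; exact: edge_tet.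
Unshelve. all: by end_near. Qed.

End Continuity.

(** Since [t] is injective, a pair [a != b] is counted at exactly one ordered edge, [(t a, t b)].
    This turns a sum over edges of angle rates into a sum over the edges of each tetrahedron. *)
Lemma sum_edges_tet t (rho : 'I_4 -> 'I_4 -> R) (w : 'I_N -> 'I_N -> R) : t \in T ->
  \sum_i \sum_(j | is_edge T i j)
    (\sum_a \sum_(b | (t a == i) && (t b == j)) rho a b) * w i j =
  \sum_a \sum_(b | b != a) rho a b * w (t a) (t b).
Proof.
move=> tT.
pose z a b i j := if [&& is_edge T i j, t a == i & t b == j] then rho a b * w i j else 0.
transitivity (\sum_i \sum_j \sum_a \sum_b z a b i j).
  apply: eq_bigr => i _; rewrite big_mkcond; apply: eq_bigr => j _; rewrite /z.
  case: ifP => _; last by rewrite !big1 // => a _; rewrite big1.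
  rewrite mulr_suml; apply: eq_bigr => a _; rewrite mulr_suml big_mkcond.
  by apply: eq_bigr => b _.
rewrite pair_bigA /=; under eq_bigr do rewrite pair_bigA.
rewrite exchange_big /= -(pair_bigA _ (fun a b => \sum_p z a b p.1 p.2)) /=.
apply: eq_bigr => a _; rewrite [RHS]big_mkcond; apply: eq_bigr => b _.
rewrite -(pair_bigA _ (fun i j => z a b i j)) /= (bigD1 (t a)) //= (bigD1 (t b)) //=.
rewrite [X in _ + X + _]big1 => [|j jb]; last by rewrite /z [t b == j]eq_sym (negbTE jb) !andbF.
rewrite [X in _ + _ + X]big1 => [|i ia]; last first.
  by apply: big1 => j _; rewrite /z [t a == i]eq_sym (negbTE ia) andbF.
rewrite !addr0 /z !eqxx !andbT; have [->|ba] := eqVneq b a.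
  by rewrite /is_edge eqxx.
by rewrite edge_tet // eq_sym.
Qed.

(** * Derivatives along a line of radii *)

Section Line.
Variables r0 v : 'I_N -> R.

Definition line (s : R) (i : 'I_N) : R := r0 i + s * v i.

Lemma line_derive i (t : R) : is_derive t 1 (line^~ i) (v i).
Proof.
apply: is_derive_eq (is_derive1D (is_derive1_const _ t)
  (is_derive1M (is_derive_id t (1 : R)) (is_derive1_const (v i) t))) _.
by ring.
Qed.

Let sinh_line i (t : R) := is_derive1_sinh_comp (line_derive i t).
Let cosh_line i (t : R) := is_derive1_cosh_comp (line_derive i t).
Let cos_cst i j (t : R) := is_derive1_const (cos (Phi i j)) t.

Lemma ch_derive i j (t : R) :
  is_derive t 1 (fun s => ch (line s) i j) (dch (line t) v i j).
Proof.
apply: is_derive_eq (is_derive1D (is_derive1M (sinh_line i t) (sinh_line j t))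
  (is_derive1M (is_derive1M (cos_cst i j t) (cosh_line i t)) (cosh_line j t))) _.
by rewrite /dch /ch_partial (PhiC j i); ring.
Qed.

Lemma ch_partial_derive i j (t : R) :
  is_derive t 1 (fun s => ch_partial (line s) i j)
   (ch (line t) i j * v i +
    (cosh (line t i) * cosh (line t j) +
     cos (Phi i j) * sinh (line t i) * sinh (line t j)) * v j).
Proof.
apply: is_derive_eq (is_derive1D (is_derive1M (cosh_line i t) (sinh_line j t))
  (is_derive1M (is_derive1M (cos_cst i j t) (sinh_line i t)) (cosh_line j t))) _.
by rewrite /cosh_len; ring.
Qed.

Lemma dch_derive i j (t : R) :
  is_derive t 1 (fun s => dch (line s) v i j) (d2ch (line t) v i j).
Proof.
apply: is_derive_eq (is_derive1D
  (is_derive1M (ch_partial_derive i j t) (is_derive1_const (v i) t))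
  (is_derive1M (ch_partial_derive j i t) (is_derive1_const (v j) t))) _.
by rewrite /d2ch (chC (line t) j i) (PhiC j i); ring.
Qed.

Lemma dlen_derive i j (t : R) : 1 < ch (line t) i j ->
  is_derive t 1 (fun s => dlen (line s) v i j) (d2len (line t) v i j).
Proof.
move=> c1; have s0 := sh_gt0 c1.
have arg0 : 0 < ch (line t) i j * ch (line t) i j + - 1.
  by rewrite subr_gt0 -expr2 expr_gt1 // ltW // (lt_trans ltr01).
have dsh := @is_derive1_sqrt_comp _ (fun s => ch (line s) i j * ch (line s) i j + - 1) t _ arg0
  (is_derive1D (is_derive1M (ch_derive i j t) (ch_derive i j t)) (is_derive1_const (-1) t)).
apply: is_derive_eq (@is_derive1_div _ (fun s => dch (line s) v i j)
  (fun s => sh (line s) i j) t _ _ (lt0r_neq0 s0) (dch_derive i j t) dsh) _.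
have shE : Num.sqrt (ch (line t) i j * ch (line t) i j + - 1) = sh (line t) i j.
  by rewrite /sh expr2.
rewrite /= ?shE /d2len; field.
by rewrite gt_eqF.
Qed.

Definition angle_rate r t a b : R :=
  let H := invmx (gram (tet_ch r t)) in let c := opp1 a b in let d := opp2 a b in
  offdiag_rate H (H *m tet_dch r v t *m H) c d / Num.sqrt (minor2 H c d).

Lemma edge_curv_derive i j (s : R) : near_metric (line s) -> i != j ->
  is_derive s 1 (fun x => edge_curv (line x) i j)
   (- \sum_(t <- T | t \in T) \sum_a \sum_(b | (t a == i) && (t b == j))
       angle_rate (line s) t a b).
Proof.
move=> [_ adm] ij; apply: is_derive_eq (is_derive1D (is_derive1_const (2 * pi) s)
  (is_derive1N (is_derive1_sum _ _))) _; last by rewrite add0r.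
move=> t tT; apply: is_derive1_sum => a _; apply: is_derive1_sum => b /andP[/eqP ai /eqP bj].
apply: gram_angle_derive; first exact: adm.
- by apply: contra ij => /eqP ab; rewrite -ai -bj ab.
- by move=> k; rewrite mxE eqxx.
- by move=> k l kl; rewrite mxE (negbTE kl); exact: ch_derive.
Qed.

(** By [inv_gram_minor], [sinh l] is the root of the 2x2 minor times the root of minus the
    determinant, so the two roots of the minor multiply to the minor itself. *)
Lemma angle_rate_dlen r t a b : near_metric r -> t \in T -> a != b ->
  angle_rate r t a b * dlen r v (t a) (t b) =
  tet_dch r v t a b *
   (let H := invmx (gram (tet_ch r t)) in
    offdiag_rate H (H *m tet_dch r v t *m H) (opp1 a b) (opp2 a b) /
    minor2 H (opp1 a b) (opp2 a b)) / Num.sqrt (- \det (gram (tet_ch r t))).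
Proof.
move=> [_ adm] tT ab /=; have at_ := adm _ tT; have [_ _ det] := at_.
have m0 := gram_minor_gt0 at_ ab.
have g0 : 0 < - \det (gram (tet_ch r t)) by rewrite oppr_gt0.
rewrite /angle_rate mxE (negbTE ab) /dlen.
have -> : sh r (t a) (t b) = Num.sqrt (minor2 (invmx (gram (tet_ch r t))) (opp1 a b) (opp2 a b))
   * Num.sqrt (- \det (gram (tet_ch r t))).
  by rewrite -sqrtrM ?ltW // inv_gram_minor // divfK ?gt_eqF.
have Sm : 0 < Num.sqrt (minor2 (invmx (gram (tet_ch r t))) (opp1 a b) (opp2 a b)).
  by rewrite sqrtr_gt0.
have Sg : 0 < Num.sqrt (- \det (gram (tet_ch r t))) by rewrite sqrtr_gt0.
move: m0 Sm; set m := minor2 _ _ _ => m0; set q := Num.sqrt m => Sm.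
have mE : m = q ^+ 2 by rewrite sqr_sqrtr // ltW.
rewrite mE; field.
by rewrite !gt_eqF.
Qed.

Lemma pairing_derive (s : R) : near_metric (line s) ->
  is_derive s 1
   (fun x => \sum_i \sum_(j | is_edge T i j) edge_curv (line x) i j * dlen (line x) v i j)
   (hess_form (line s) v).
Proof.
move=> nr; have [e1 adm] := nr.
pose dK i j := - \sum_(t <- T | t \in T) \sum_a \sum_(b | (t a == i) && (t b == j))
   angle_rate (line s) t a b.
have key : \sum_i \sum_(j | is_edge T i j) dK i j * dlen (line s) v i j =
    - \sum_(t <- T | t \in T)
      tet_form (invmx (gram (tet_ch (line s) t))) (tet_dch (line s) v t) /
      Num.sqrt (- \det (gram (tet_ch (line s) t))).
  transitivity (- \sum_(t <- T | t \in T) \sum_i \sum_(j | is_edge T i j)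
      (\sum_a \sum_(b | (t a == i) && (t b == j)) angle_rate (line s) t a b)
      * dlen (line s) v i j).
    rewrite exchange_big /= -sumrN; apply: eq_bigr => i _.
    rewrite exchange_big /= -sumrN; apply: eq_bigr => j _.
    by rewrite /dK mulNr mulr_suml.
  congr (- _); apply: eq_bigr => t tT; rewrite sum_edges_tet // /tet_form mulr_suml.
  apply: eq_bigr => a _; rewrite mulr_suml; apply: eq_bigr => b ba.
  by rewrite angle_rate_dlen // eq_sym.
have : is_derive s 1
   (fun x => \sum_i \sum_(j | is_edge T i j) edge_curv (line x) i j * dlen (line x) v i j)
   (\sum_i \sum_(j | is_edge T i j) (dK i j * dlen (line s) v i j
    + edge_curv (line s) i j * d2len (line s) v i j)).
  apply: is_derive1_sum => i _; apply: is_derive1_sum => j ij; apply: is_derive1M.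
    by apply: edge_curv_derive => //; case/andP: ij.
  by apply: dlen_derive; exact: e1.
move=> /is_derive_eq; apply.
rewrite /hess_form -key addrC -big_split /=; apply: eq_bigr => i _.
by rewrite -big_split.
Qed.

End Line.

(** * Homogeneity and local injectivity *)

Lemma tet_formZ (H u : 'M[R]_4) k : tet_form H (k *: u) = k ^+ 2 * tet_form H u.
Proof.
rewrite /tet_form mulr_sumr; apply: eq_bigr => a _; rewrite mulr_sumr; apply: eq_bigr => b _.
by rewrite /offdiag_rate -scalemxAr -scalemxAl !(mxE _ _ a b) !mxE; ring.
Qed.

Lemma hess_formZ r k v : hess_form r (fun i => k * v i) = k ^+ 2 * hess_form r v.
Proof.
have dZ i j : dch r (fun i => k * v i) i j = k * dch r v i j by rewrite /dch; ring.
have tZ t : tet_dch r (fun i => k * v i) t = k *: tet_dch r v t.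
  by apply/matrixP => a b; rewrite !mxE dZ; case: eqVneq; rewrite ?mulr0.
rewrite /hess_form mulrBr; congr (_ - _).
  rewrite mulr_sumr; apply: eq_bigr => i _; rewrite mulr_sumr; apply: eq_bigr => j _.
  by rewrite /d2len dZ /d2ch; ring.
by rewrite mulr_sumr; apply: eq_bigr => t _; rewrite tZ tet_formZ mulrA.
Qed.

Lemma near_injective r0 : sp_metric T Phi r0 ->
  (forall i, has (fun t : {ffun 'I_4 -> 'I_N} => i \in codom t) T) ->
  (forall i j, is_edge T i j -> 0 <= cos (Phi i j)) ->
  (forall i j, is_edge T i j -> 0 <= Kedge T Phi r0 i j * sin (Phi i j) ^+ 2) ->
  exists2 eps : R, 0 < eps & forall r1 r2,
    (forall i, `|r1 i - r0 i| < eps) -> (forall i, `|r2 i - r0 i| < eps) ->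
    (forall i, Kvert T Phi r1 i = Kvert T Phi r2 i) -> r1 = r2.
Proof.
move=> spr cover c0 K0; have nr0 := sp_metric_near spr.
(* Radii become row vectors, where the norm and the compactness of the unit sphere are available. *)
pose fn (x : 'rV[R]_N) : 'I_N -> R := fun i => x 0 i.
pose x0 : 'rV[R]_N := \row_i r0 i.
have fnx0 : fn x0 = r0 by apply/funext => i; rewrite /fn mxE.
have fn_cvg i : fn x i @[x --> x0] --> r0 i by rewrite -fnx0; exact: coord_continuous.
have near_nm : \forall x \near x0, near_metric (fn x).
  exact: (@near_metric_near _ (nbhs x0) _ fn r0 fn_cvg nr0).
have near_neg : \forall x \near x0, forall w : 'rV[R]_N, w != 0 -> 0 < - hess_form (fn x) (fn w).
  apply: (@near_pos_form R _ (nbhs x0) _ N (fun x w => - hess_form (fn x) (fn w))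
     (fun w => - hess_form r0 (fn w))).
  - move=> x k w; rewrite (_ : fn (k *: w) = fun i => k * fn w i) ?hess_formZ ?mulrN //.
    by apply/funext => i; rewrite /fn mxE.
  - move=> w w0; rewrite oppr_gt0; apply: hess_form_lt0 => //.
    apply/not_existsP => h; move/eqP: w0; apply; apply/rowP => i; rewrite mxE.
    by apply/eqP/negPn/negP => wi; apply: (h i).
  - move=> w; apply: cvgN; apply: hess_form_cvg => // i.
      by apply: (@cvg_comp _ _ _ snd (fun x => fn x i) _ _ _ cvg_snd); exact: fn_cvg.
    apply: (@cvg_comp _ _ _ fst (fun x : 'rV[R]_N => x 0 i) _ _ _ cvg_fst).
    exact: coord_continuous.
have near_both : \forall x \near x0, near_metric (fn x) /\
    forall w : 'rV[R]_N, w != 0 -> 0 < - hess_form (fn x) (fn w) by exact: filterI.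
have /nbhs_ballP[e /= e0 he] := near_both.
exists e => // r1 r2 hr1 hr2 EK.
pose v i := r1 i - r2 i.
(* Balls of row vectors are boxes, hence convex, so the whole segment from [r2] to [r1] stays where
   the form is negative definite. *)
have in_ball (s : R) : 0 <= s <= 1 -> ball x0 e (\row_i line r2 v s i).
  move=> /andP[s0 s1]; split=> // k i; rewrite /ball /= !mxE /line /v.
  have -> : r0 i - (r2 i + s * (r1 i - r2 i)) =
    - ((1 - s) * (r2 i - r0 i) + s * (r1 i - r0 i)) by ring.
  rewrite normrN; apply: (le_lt_trans (ler_normD _ _)); rewrite !normrM.
  rewrite (ger0_norm s0) (@ger0_norm _ (1 - s)) ?subr_ge0 //.
  have := hr1 i; have := hr2 i; move: `|r1 i - r0 i| `|r2 i - r0 i| => a b hb ha.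
  have am : a <= Num.max a b by rewrite le_max lexx.
  have bm : b <= Num.max a b by rewrite le_max lexx orbT.
  apply: (@le_lt_trans _ _ (Num.max a b)); last by rewrite gt_max ha hb.
  have h1 : s * a <= s * Num.max a b by rewrite ler_wpM2l.
  have h2 : (1 - s) * b <= (1 - s) * Num.max a b by rewrite ler_wpM2l // subr_ge0.
  by lra.
have lineE s : fn (\row_i line r2 v s i) = line r2 v s.
  by apply/funext => i; rewrite /fn mxE.
have nm (s : R) : 0 <= s <= 1 -> near_metric (line r2 v s).
  by move=> /in_ball/he[+ _]; rewrite lineE.
(* Twice the pairing of the vertex curvatures with [v]; equal curvatures at the ends give
   [G 0 = G 1]. *)
pose G s := \sum_i \sum_(j | is_edge T i j)
  edge_curv (line r2 v s) i j * dlen (line r2 v s) v i j.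
have dG (s : R) : 0 <= s <= 1 -> is_derive s 1 G (hess_form (line r2 v s) v).
  by move=> /nm; exact: pairing_derive.
have line0 : line r2 v 0 = r2 by apply/funext => i; rewrite /line mul0r addr0.
have line1 : line r2 v 1 = r1 by apply/funext => i; rewrite /line /v mul1r addrC subrK.
have G01 : G 0 = G 1.
  have n0 := nm 0 ltac:(by rewrite lexx ler01); have n1 := nm 1 ltac:(by rewrite lexx ler01).
  have S0 := sum_Kvert v n0; have S1 := sum_Kvert v n1.
  apply: (@mulfI _ 2^-1) => //; rewrite -S0 -S1 line0 line1.
  by apply: eq_bigr => i _; rewrite EK.
apply/funext => i; apply/eqP/negPn/negP => ri.
have [||c] := @Rolle R G 0 1 ltr01 _ _ G01.
- move=> x; rewrite in_itv /= => /andP[xl xr].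
  by have [] := dG x ltac:(by rewrite !ltW).
- by apply: derivable_within_continuous => x; rewrite in_itv /= => /dG[].
rewrite in_itv /= => /andP[cl cr] dc.
have c01 : 0 <= c <= 1 by rewrite !ltW.
(* At the Rolle point the form vanishes on the nonzero vector [v], against definiteness. *)
have [_ /(_ (\row_i v i))] := he _ (in_ball c c01).
rewrite lineE (_ : fn (\row_i v i) = v); last by apply/funext => k; rewrite /fn mxE.
have -> : hess_form (line r2 v c) v = 0.
  have := dG c c01 => -[_ <-]; exact: derive_val.
rewrite oppr0 ltxx => H; have : false by apply: H; apply/eqP => /rowP /(_ i) /eqP; rewrite !mxE subr_eq0 (negbTE ri).
by [].
Qed.

End Packing.

Unset Implicit Arguments.

Theorem theorem1p6 (R : realType) (N : nat) (T : seq {ffun 'I_4 -> 'I_N})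
  (Phi : 'I_N -> 'I_N -> R) (rbar : 'I_N -> R) :
  (* tetrahedra have four distinct vertices; every vertex is in a tetrahedron *)
  (forall t, t \in T -> injective t) ->
  (forall i : 'I_N, has (fun t : {ffun 'I_4 -> 'I_N} => i \in codom t) T) ->
  (* weight Phi : E -> [0, arccos (1/3)] (symmetric in the two endpoints) *)
  (forall i j, Phi i j = Phi j i) ->
  (forall i j, is_edge T i j -> 0 <= Phi i j <= acos (3^-1)) ->
  sp_metric T Phi rbar ->
  (forall i j, is_edge T i j -> 0 <= Kedge T Phi rbar i j * sin (Phi i j) ^+ 2) ->
  exists2 eps : R, 0 < eps &
    forall r1 r2 : 'I_N -> R,
      (forall i, `|r1 i - rbar i| < eps) -> (forall i, `|r2 i - rbar i| < eps) ->
      sp_metric T Phi r1 -> sp_metric T Phi r2 ->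
      (forall i, Kvert T Phi r1 i = Kvert T Phi r2 i) ->
      r1 = r2.
Proof.
move=> T_inj cover PhiC Phi_itv spm K_ge0.
have cos_ge0 i j : is_edge T i j -> 0 <= cos (Phi i j).
  move=> /Phi_itv/andP[P0 P1].
  have third : -1 <= (3^-1 : R) <= 1 by apply/andP; split; lra.
  have E : cos (acos (3^-1 : R)) = 3^-1 by apply: acosK; rewrite in_itv.
  (* The cosine decreases on [[0, pi]], so the upper bound on [Phi] gives
     [3^-1 <= cos (Phi i j)]. *)
  have Pin : Phi i j \in `[0, pi] by rewrite in_itv /= P0 (le_trans P1) // acos_lepi.
  have ain : acos (3^-1 : R) \in `[0, pi] by rewrite in_itv /= acos_ge0 // acos_lepi.
  apply: (@le_trans _ _ (cos (acos 3^-1))); first by rewrite E; lra.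
  by rewrite leNgt ltr_cos // -leNgt.
have [eps eps0 inj] := near_injective T_inj PhiC spm cover cos_ge0 K_ge0.
by exists eps => // r1 r2 h1 h2 _ _; exact: inj.
Qed.
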